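(* $\mathsf{fc}\text{-}\mathsf{MATLANG}$ and $\mathsf{FO}^{\wedge}_2$ are equally expressive: (1) for every $\mathsf{fc}\text{-}\mathsf{MATLANG}$ query $\mathbf{Q}$ over a matrix schema $\mathcal{S}$ and every matrix-to-relational schema encoding $\mathrm{Rel}$ on $\mathcal{S}(\mathbf{Q})$ there is an $\mathsf{FO}^{\wedge}_2$ query simulating $\mathbf{Q}$ w.r.t. $\mathrm{Rel}$ and well-typed w.r.t. $\mathrm{Rel}^{-1}$; (2) for every $\mathsf{FO}^{\wedge}_2$ query $Q$ over a vocabulary $\sigma$ and every relational-to-matrix schema encoding $\mathrm{Mat}$ on $\sigma(Q)$ such that $Q$ is well-typed w.r.t. $\mathrm{Mat}$, there is an $\mathsf{fc}\text{-}\mathsf{MATLANG}$ query simulating $Q$ w.r.t. $\mathrm{Mat}$.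
   Context: Fix a commutative semiring $(K,\oplus,\odot,\mathbb{0},\mathbb{1})$ with $\mathbb{0}\neq\mathbb{1}$. Matrix side: size symbols (incl. $1$), matrix symbols with types $(\alpha,\beta)$, schemas $\mathcal{S}$, instances $\mathcal{I}$ (size symbols to positive integers with $1\mapsto 1$; $\mathbf{A}:(\alpha,\beta)$ to $\alpha^{\mathcal{I}}\times\beta^{\mathcal{I}}$ $K$-matrices). $\mathsf{MATLANG}$ expressions: $e::=\mathbf{A}\mid e^T\mid e_1\cdot e_2\mid e_1+e_2\mid e_1\times e_2\mid e_1\odot e_2\mid\mathbf{1}^\alpha\mid\mathbf{I}^\alpha$ (well-typed; $\cdot$ matrix product over $K$; $\times$ scalar multiplication by a $(1,1)$ expression; $\odot$ entrywise product; $\mathbf{1}^\alpha$ the all-ones column vector of type $(\alpha,1)$; $\mathbf{I}^\alpha$ the identity of type $(\alpha,\alpha)$). $\mathsf{fc}\text{-}\mathsf{MATLANG}$ is generated by $e::=\mathbf{A}\mid\mathbf{1}^\alpha\mid\mathbf{I}^\alpha\mid e^T\mid e_1\times e_2\mid e_1\odot e_2\mid e_1\cdot v_2\mid v_1\cdot e_2$ where $v_1,v_2$ are expressions of type $(\alpha,1)$ or $(1,\alpha)$. A query is $\mathbf{H}:=e$; its output extends the instance with $\mathbf{H}$ mapped to the value of $e$; $\mathcal{S}(\mathbf{Q})=\mathcal{S}\cup\{\mathbf{H}\}$. Relational side: $K$-relations over $\mathbb{N}_{>0}$ with finite support; vocabularies (relation symbols, constant symbols including $1$); databases ($1^{db}=1$).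 Formulas from $R(\bar x)$ and $x\le c$ by $\exists,\wedge,\vee$ with semiring semantics; queries $H(\bar x)\leftarrow\varphi$ (output $H(\bar d)$ = value of $\varphi$ on $\bar x\mapsto\bar d$ if $\bar d$ respects repetitions in $\bar x$, else $\mathbb{0}$). $\mathsf{FO}^{\wedge}_2$: disjunction-free formulas using at most two distinct variables in total (variables may be re-quantified); an $\mathsf{FO}^{\wedge}_2$ query is a binary query (all relations of arity $\le 2$) with $\mathsf{FO}^{\wedge}_2$ body. Encodings and simulation: $\mathrm{Rel}$ is a bijection from $\mathcal{S}$ onto a vocabulary mapping size symbols to constants ($1\mapsto1$) and matrix symbols to relation symbols of arity $\le2$ (unary only for vector types $(\alpha,1),(1,\alpha)$, nullary only for $(1,1)$); $\mathrm{Rel}(\mathcal{I})$ stores $\alpha^{\mathcal{I}}$ in $\mathrm{Rel}(\alpha)$ and the entries of $\mathbf{A}^{\mathcal{I}}$ in $\mathrm{Rel}(\mathbf{A})$ ($\mathbb{0}$ outside the dimensions). $\mathrm{Mat}$ is a bijection from a vocabulary onto a schema mapping constants to size symbols ($1\mapsto1$), unary relations to vector types and nullary ones to $(1,1)$; $db$ consistent with $\mathrm{Mat}$ means each $R^{db}$ is $\mathbb{0}$ outside the $c^{db}\times d^{db}$ range where $\mathrm{Mat}(R):(\mathrm{Mat}(c),\mathrm{Mat}(d))$, and $\mathrm{Mat}(db)$ is then the encoded matrix instance. $Q$ simulates $\mathbf{Q}$ w.r.t. $\mathrm{Rel}$ if $\mathrm{Rel}([\![\mathbf{Q}]\!](\mathcal{I}))=[\![Q]\!](\mathrm{Rel}(\mathcal{I}))$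 for all $\mathcal{I}$; $\mathbf{Q}$ simulates $Q$ w.r.t. $\mathrm{Mat}$ if $\mathrm{Mat}([\![Q]\!](db))=[\![\mathbf{Q}]\!](\mathrm{Mat}(db))$ for all $db$ consistent with $\mathrm{Mat}$. Well-typedness $\mathrm{Mat}\vdash\varphi:\tau$: $R(x_1,x_2):\{x_1\mapsto\alpha,x_2\mapsto\beta\}$ if $\mathrm{Mat}(R):(\alpha,\beta)$; $R(x):\{x\mapsto\alpha\}$ if type $(\alpha,1)$ or $(1,\alpha)$; $R():\{\}$ if $(1,1)$; $x\le c:\{x\mapsto\mathrm{Mat}(c)\}$; $\exists$ restricts; $\wedge,\vee$ union agreeing typings. $H(\bar x)\leftarrow\varphi$ is well-typed if $\mathrm{Mat}\vdash\varphi:\tau$ and $\mathrm{Mat}(H)$ has type $(\tau(x_1),\tau(x_2))$ for $\bar x=(x_1,x_2)$, or $(\tau(x),1)$ or $(1,\tau(x))$ for $\bar x=(x)$. *)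

(* Defs.v *)
From HB Require Import structures.
From mathcomp Require Import all_boot all_order all_algebra.
From mathcomp Require Import finmap.
From mathcomp Require Import boolp classical_sets functions cardinality fsbigop.

Set Implicit Arguments.
Unset Strict Implicit.
Unset Printing Implicit Defensive.

Import GRing.Theory.

(* Positive natural numbers: dimensions, row/column indices and data values. *)
Record posn := PosN { posn_val :> nat; _ : 0 < posn_val }.
HB.instance Definition _ := [isSub for posn_val].
HB.instance Definition _ := [Choice of posn by <:].

Definition pone : posn := @PosN 1 isT.

(* The entry of a matrix at 1-based indices, 0 outside its dimensions. *)
Definition entry (K : nmodType) m n (M : 'M[K]_(m, n)) (i j : posn) : K :=
  match insub i.-1, insub j.-1 with
  | Some i', Some j' => M i' j'
  | _, _ => 0%R
  end.

(** * Symbols, matrix schemas and instances *)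

(* None is the special size symbol 1 *)
Definition size_sym := option nat.
Definition One : size_sym := None.

(* Each matrix symbol carries its fixed type (mrow, mcol). *)
Record mat_sym := MatSym { mname : nat; mrow : size_sym; mcol : size_sym }.

Definition mat_sym_rep (A : mat_sym) := (mname A, mrow A, mcol A).
Definition mat_sym_of (t : nat * size_sym * size_sym) :=
  MatSym t.1.1 t.1.2 t.2.
Lemma mat_sym_repK : cancel mat_sym_rep mat_sym_of. Proof. by case. Qed.
HB.instance Definition _ := Choice.copy mat_sym (can_type mat_sym_repK).

(* The types of vectors, (alpha, 1) or (1, alpha); scalars are included. *)
Definition vec_type (a b : size_sym) : bool := (a == One) || (b == One).

Record schema := Schema {
  sch_sizes : {fset size_sym};
  sch_mats : {fset mat_sym};
  sch_one : One \in sch_sizes;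
  sch_closed : {in sch_mats, forall A,
    (mrow A \in sch_sizes) && (mcol A \in sch_sizes)} }.

(* An instance interprets every symbol; an instance over a schema S is its
   restriction to S, so equality of instances over S is inst_eq S. *)
Record instance (K : comNzSemiRingType) := Instance {
  size_dim : size_sym -> posn;
  size_dim_one : size_dim One = pone;
  mat : forall A : mat_sym, 'M[K]_(size_dim (mrow A), size_dim (mcol A)) }.

Definition inst_eq (K : comNzSemiRingType) (S : schema) (I J : instance K) :=
  {in sch_sizes S, forall a, size_dim I a = size_dim J a} /\
  {in sch_mats S, forall A, forall i j : posn,
    entry (mat I A) i j = entry (mat J A) i j}.

(** * MATLANG *)

(* Well-typed MATLANG expressions, indexed by their type. *)
Inductive expr : size_sym -> size_sym -> Type :=
| EMat (A : mat_sym) : expr (mrow A) (mcol A)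
| ETr a b : expr a b -> expr b a
| EMul a b c : expr a b -> expr b c -> expr a c
| EAdd a b : expr a b -> expr a b -> expr a b
| EScal a b : expr One One -> expr a b -> expr a b
| EHad a b : expr a b -> expr a b -> expr a b
| EOnes a : expr a One
| EId a : expr a a.

Fixpoint expr_over (S : schema) a b (e : expr a b) : bool :=
  match e with
  | EMat A => A \in sch_mats S
  | ETr _ _ e1 => expr_over S e1
  | EMul _ _ _ e1 e2 => expr_over S e1 && expr_over S e2
  | EAdd _ _ e1 e2 => expr_over S e1 && expr_over S e2
  | EScal _ _ e1 e2 => expr_over S e1 && expr_over S e2
  | EHad _ _ e1 e2 => expr_over S e1 && expr_over S e2
  | EOnes a => a \in sch_sizes S
  | EId a => a \in sch_sizes S
  end.

Lemma expr_over_type S a b (e : expr a b) : expr_over S e ->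
  (a \in sch_sizes S) && (b \in sch_sizes S).
Proof.
elim: e => {a b}
  [A|a b e IH|a b c e1 IH1 e2 IH2|a b e1 IH1 e2 IH2|a b e1 IH1 e2 IH2
  |a b e1 IH1 e2 IH2|a|a] /=.
- exact: sch_closed.
- by move/IH; rewrite andbC.
- by case/andP=> /IH1/andP[-> _] /IH2/andP[_ ->].
- by case/andP=> /IH1.
- by case/andP=> _ /IH2.
- by case/andP=> /IH1.
- by move->; rewrite sch_one.
- by move->.
Qed.

Fixpoint is_fc a b (e : expr a b) : bool :=
  match e with
  | EMat _ | EOnes _ | EId _ => true
  | ETr _ _ e1 => is_fc e1
  | EMul a b c e1 e2 =>
      [&& is_fc e1, is_fc e2 & vec_type a b || vec_type b c]
  | EAdd _ _ _ _ => false
  | EScal _ _ e1 e2 => is_fc e1 && is_fc e2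
  | EHad _ _ e1 e2 => is_fc e1 && is_fc e2
  end.

Section EvalMatlang.
Variables (K : comNzSemiRingType) (I : instance K).
Local Open Scope ring_scope.

Fixpoint eval a b (e : expr a b) : 'M[K]_(size_dim I a, size_dim I b) :=
  match e in expr a b return 'M[K]_(size_dim I a, size_dim I b) with
  | EMat A => mat I A
  | ETr _ _ e1 => (eval e1)^T
  | EMul _ _ _ e1 e2 => eval e1 *m eval e2
  | EAdd _ _ e1 e2 => eval e1 + eval e2
  | EScal _ _ e1 e2 => entry (eval e1) pone pone *: eval e2
  | EHad _ _ e1 e2 => \matrix_(i, j) (eval e1 i j * eval e2 i j)
  | EOnes _ => const_mx 1
  | EId _ => 1%:M
  end.
End EvalMatlang.

Record mquery (S : schema) := MQuery {
  mq_head : mat_sym;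
  mq_body : expr (mrow mq_head) (mcol mq_head);
  mq_fresh : mq_head \notin sch_mats S;
  mq_over : expr_over S mq_body }.

Lemma mq_schema_closed S (Q : mquery S) :
  {in (mq_head Q |` sch_mats S)%fset, forall A,
    (mrow A \in sch_sizes S) && (mcol A \in sch_sizes S)}.
Proof.
move=> A; rewrite !inE => /orP[/eqP->|]; last exact: sch_closed.
exact: expr_over_type (mq_over Q).
Qed.

Definition mq_schema S (Q : mquery S) : schema :=
  Schema (sch_one S) (@mq_schema_closed S Q).

Definition mq_eval (K : comNzSemiRingType) S (Q : mquery S) (I : instance K) :
    instance K :=
  @Instance K (size_dim I) (size_dim_one I) (dfwith (mat I) (eval I (mq_body Q))).

Definition is_fc_query S (Q : mquery S) : bool := is_fc (mq_body Q).

(** * Vocabularies and databases *)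

(* None is the special constant symbol 1 *)
Definition const_sym := option nat.
Definition COne : const_sym := None.

Record rel_sym := RelSym { rname : nat; arity : nat }.

Definition rel_sym_rep (R : rel_sym) := (rname R, arity R).
Definition rel_sym_of (t : nat * nat) := RelSym t.1 t.2.
Lemma rel_sym_repK : cancel rel_sym_rep rel_sym_of. Proof. by case. Qed.
HB.instance Definition _ := Choice.copy rel_sym (can_type rel_sym_repK).

Record vocab := Vocab {
  voc_consts : {fset const_sym};
  voc_rels : {fset rel_sym};
  voc_one : COne \in voc_consts }.

Record krel (K : comNzSemiRingType) (k : nat) := KRel {
  krel_fun :> k.-tuple posn -> K;
  krel_fin : finite_set [set t | krel_fun t != 0%R]%classic }.

(* As for instances, a database over a vocabulary sigma is the restriction of
   a total interpretation to sigma, with db_eq sigma as equality. *)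
Record database (K : comNzSemiRingType) := Database {
  dconst : const_sym -> posn;
  dconst_one : dconst COne = pone;
  drel : forall R : rel_sym, krel K (arity R) }.

Definition db_eq (K : comNzSemiRingType) (sg : vocab) (db1 db2 : database K) :=
  {in voc_consts sg, forall c, dconst db1 c = dconst db2 c} /\
  {in voc_rels sg, forall R, drel db1 R =1 drel db2 R}.

(** * First-order queries *)

Definition var := nat.

Inductive formula :=
| FAtom (R : rel_sym) of (arity R).-tuple var
| FLe of var & const_sym
| FEx of var & formula
| FAnd of formula & formula
| FOr of formula & formula.

Fixpoint free_vars (f : formula) : seq var :=
  match f with
  | FAtom _ xs => xs
  | FLe x _ => [:: x]
  | FEx x g => [seq y <- free_vars g | y != x]
  | FAnd g h | FOr g h => free_vars g ++ free_vars h
  end.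

Fixpoint vars (f : formula) : seq var :=
  match f with
  | FAtom _ xs => xs
  | FLe x _ => [:: x]
  | FEx x g => x :: vars g
  | FAnd g h | FOr g h => vars g ++ vars h
  end.

Fixpoint form_over (sg : vocab) (f : formula) : bool :=
  match f with
  | FAtom R _ => R \in voc_rels sg
  | FLe _ c => c \in voc_consts sg
  | FEx _ g => form_over sg g
  | FAnd g h | FOr g h => form_over sg g && form_over sg h
  end.

(* Both sides of a disjunction have the same free variables; otherwise its
   value need not have finite support. *)
Fixpoint safe (f : formula) : Prop :=
  match f with
  | FAtom _ _ | FLe _ _ => True
  | FEx _ g => safe g
  | FAnd g h => safe g /\ safe h
  | FOr g h => [/\ safe g, safe h & free_vars g =i free_vars h]
  end.

Fixpoint disj_free (f : formula) : bool :=
  match f with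
  | FAtom _ _ | FLe _ _ => true
  | FEx _ g => disj_free g
  | FAnd g h => disj_free g && disj_free h
  | FOr _ _ => false
  end.

Fixpoint form_binary (f : formula) : bool :=
  match f with
  | FAtom R _ => arity R <= 2
  | FLe _ _ => true
  | FEx _ g => form_binary g
  | FAnd g h | FOr g h => form_binary g && form_binary h
  end.

Definition valuation := var -> posn.

Definition vset (v : valuation) (x : var) (d : posn) : valuation :=
  fun y => if y == x then d else v y.

Section Semantics.
Variables (K : comNzSemiRingType) (db : database K).
Local Open Scope ring_scope.

(* The sum for an existential quantifier ranges over the valuations of
   free_vars g that extend v, so there is only one if x is not free in g. *)
Fixpoint sem (f : formula) (v : valuation) : K :=
  match f with
  | FAtom R xs => drel db R (map_tuple v xs)
  | FLe x c => if (v x <= dconst db c)%N then 1 else 0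
  | FEx x g =>
      if x \in free_vars g then \sum_(d \in [set: posn]) sem g (vset v x d)
      else sem g v
  | FAnd g h => sem g v * sem h v
  | FOr g h => sem g v + sem h v
  end.

Lemma sem_bounded f : safe f -> exists B : nat, forall v,
  sem f v != 0 -> {in free_vars f, forall x, (v x <= B)%N}.
Proof.
elim: f => [R xs|x c|x g IH|g IHg h IHh|g IHg h IHh] /=.
- move=> _; have /finite_seqP[s hs] := krel_fin (drel db R).
  exists (\max_(t <- s) \max_(d <- (t : seq posn)) (d : nat))%N => v nz x xin.
  set t := map_tuple v xs.
  have ts : t \in s.
    by have : [set` s]%classic t by rewrite -hs.
  apply: leq_trans (leq_bigmax_seq _ ts isT).
  by apply: (@leq_bigmax_seq _ t xpredT posn_val); first exact: map_f.
- move=> _; exists (dconst db c) => v; case: ifP; last by rewrite eqxx.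
  by move=> le _ y; rewrite inE => /eqP->.
- move=> /IH[B hB]; exists B => v; case: ifP => xg.
    move=> nz y; rewrite mem_filter => /andP[yx yg].
    case: (pselect (exists d, sem g (vset v x d) != 0)) => [[d nzd]|no].
      by have := hB _ nzd y yg; rewrite /vset (negPf yx).
    case/eqP: nz; rewrite fsbig1 // => d _; apply/eqP/negPn/negP => nzd.
    by apply: no; exists d.
  by move=> nz y; rewrite mem_filter => /andP[_]; apply: hB.
- case=> /IHg[B1 h1] /IHh[B2 h2]; exists (maxn B1 B2) => v nz x.
  have nz1 : sem g v != 0.
    by apply: contra nz => /eqP->; rewrite mul0r.
  have nz2 : sem h v != 0.
    by apply: contra nz => /eqP->; rewrite mulr0.
  by rewrite mem_cat leq_max => /orP[/(h1 _ nz1)->|/(h2 _ nz2)->];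
    rewrite ?orbT.
- case=> /IHg[B1 h1] /IHh[B2 h2] gh; exists (maxn B1 B2) => v nz x.
  rewrite mem_cat -gh orbb leq_max => xg.
  case: (eqVneq (sem g v) 0) => [g0|nz1]; last by rewrite (h1 _ nz1).
  have nz2 : sem h v != 0 by move: nz; rewrite g0 add0r.
  by rewrite (h2 _ nz2) ?orbT // -gh.
Qed.
End Semantics.

Record rquery (sg : vocab) := RQuery {
  rq_head : rel_sym;
  rq_vars : (arity rq_head).-tuple var;
  rq_body : formula;
  rq_fresh : rq_head \notin voc_rels sg;
  rq_over : form_over sg rq_body;
  rq_safe : safe rq_body;
  rq_free : rq_vars =i free_vars rq_body }.

Definition rq_vocab sg (Q : rquery sg) : vocab :=
  @Vocab (voc_consts sg) (rq_head Q |` voc_rels sg)%fset (voc_one sg).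

(* d respects the repetitions in xs *)
Definition respects k (d : k.-tuple posn) (xs : k.-tuple var) : bool :=
  [forall i, forall j,
    (tnth xs i == tnth xs j) ==> (tnth d i == tnth d j)].

(* The valuation xs |-> d, arbitrary outside xs. *)
Definition val_of k (xs : k.-tuple var) (d : k.-tuple posn) : valuation :=
  fun x => nth pone d (index x xs).

Definition rq_fun (K : comNzSemiRingType) sg (Q : rquery sg) (db : database K)
    (d : (arity (rq_head Q)).-tuple posn) : K :=
  if respects d (rq_vars Q)
  then sem db (rq_body Q) (val_of (rq_vars Q) d) else 0%R.
Arguments rq_fun {K sg} Q db d.

Lemma finite_bounded_tuples k (B : nat) :
  finite_set [set t : k.-tuple posn | forall i, (tnth t i <= B)%N]%classic.
Proof.
pose g (u : k.-tuple 'I_B.+1) : k.-tuple posn :=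
  map_tuple (fun n : 'I_B.+1 => insubd pone (n : nat)) u.
apply: (@sub_finite_set _ _ (range g)); last first.
  exact/finite_image/finite_finset.
move=> t /= tB; exists [tuple inord (tnth t i) | i < k] => //.
apply: eq_from_tnth => i; rewrite tnth_map tnth_mktuple inordK ?ltnS ?tB //.
by apply: val_inj; rewrite val_insubd; case: (tnth t i) => n /= ->.
Qed.

Lemma rq_fun_fin (K : comNzSemiRingType) sg (Q : rquery sg)
    (db : database K) :
  finite_set [set t | rq_fun Q db t != 0%R]%classic.
Proof.
have [B hB] := sem_bounded db (rq_safe Q).
apply: sub_finite_set (finite_bounded_tuples _ B) => t /=.
rewrite /rq_fun; case: ifP; last by rewrite eqxx.
move=> /forallP rt nz i.
have xin : tnth (rq_vars Q) i \in rq_vars Q by exact: mem_tnth.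
have := hB _ nz (tnth (rq_vars Q) i); rewrite -rq_free => /(_ xin).
congr (_ <= _)%N; rewrite /val_of.
have lt : index (tnth (rq_vars Q) i) (rq_vars Q) < arity (rq_head Q).
  by rewrite -[X in _ < X](size_tuple (rq_vars Q)) index_mem.
have /forallP/(_ (Ordinal lt)) := rt i.
rewrite [tnth _ (Ordinal _)](tnth_nth 0) /= nth_index // eqxx /=.
by rewrite [tnth t (Ordinal _)](tnth_nth pone) /= => /eqP->.
Qed.

Definition rq_eval (K : comNzSemiRingType) sg (Q : rquery sg)
    (db : database K) : database K :=
  @Database K (dconst db) (dconst_one db)
    (dfwith (drel db) (KRel (rq_fun_fin Q db))).

Definition is_FO2_conj sg (Q : rquery sg) : bool :=
  [&& disj_free (rq_body Q), size (undup (vars (rq_body Q))) <= 2,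
      form_binary (rq_body Q) & arity (rq_head Q) <= 2].

(** * Encodings *)

(* A bijection between a schema and a vocabulary, given with its inverse.
   Matrix-to-relational encodings Rel are read from S to sg (enc_const,
   enc_rel), relational-to-matrix encodings Mat from sg to S (enc_size,
   enc_mat): both are subject to the same conditions, so one record serves for
   both and Rel^-1 is Rel itself read backwards. *)
Record encoding (S : schema) (sg : vocab) := Encoding {
  enc_const : size_sym -> const_sym;
  enc_size : const_sym -> size_sym;
  enc_rel : mat_sym -> rel_sym;
  enc_mat : rel_sym -> mat_sym;
  enc_const_in : {in sch_sizes S, forall a, enc_const a \in voc_consts sg};
  enc_size_in : {in voc_consts sg, forall c, enc_size c \in sch_sizes S};
  enc_rel_in : {in sch_mats S, forall A, enc_rel A \in voc_rels sg};
  enc_mat_in : {in voc_rels sg, forall R, enc_mat R \in sch_mats S};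
  enc_constK : {in sch_sizes S, cancel enc_const enc_size};
  enc_sizeK : {in voc_consts sg, cancel enc_size enc_const};
  enc_relK : {in sch_mats S, cancel enc_rel enc_mat};
  enc_matK : {in voc_rels sg, cancel enc_mat enc_rel};
  enc_one : enc_const One = COne;
  enc_arity : {in voc_rels sg, forall R, arity R <= 2};
  enc_unary : {in voc_rels sg, forall R, arity R = 1 ->
    vec_type (mrow (enc_mat R)) (mcol (enc_mat R))};
  enc_nullary : {in voc_rels sg, forall R, arity R = 0 ->
    mrow (enc_mat R) = One /\ mcol (enc_mat R) = One} }.

Lemma enc_one_size S sg (E : encoding S sg) : enc_size E COne = One.
Proof. by rewrite -(enc_one E) (enc_constK E) // sch_one. Qed.

(* The K-value at t of a relation encoding the matrix M, the value of a symbol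
   of type (a, b): vectors may be encoded by unary relations (a column if
   b = 1, a row otherwise) and scalars by nullary ones. *)
Definition rel_value (K : comNzSemiRingType) (b : size_sym) m n
    (M : 'M[K]_(m, n)) (t : seq posn) : K :=
  match t with
  | [::] => entry M pone pone
  | [:: i] => if b == One then entry M i pone else entry M pone i
  | [:: i; j] => entry M i j
  | _ => 0%R
  end.

Lemma entry_neq0 (K : nmodType) m n (M : 'M[K]_(m, n)) i j :
  entry M i j != 0%R -> (i <= m) && (j <= n).
Proof.
rewrite /entry; case: insubP => [i' im _|_]; last by rewrite eqxx.
case: insubP => [j' jn _ _|_]; last by rewrite eqxx.
by case: i j im jn => [[|i] hi] [[|j] hj] //= -> ->.
Qed.

Lemma rel_value_fin (K : comNzSemiRingType) b m n (M : 'M[K]_(m, n)) k :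
  finite_set [set t : k.-tuple posn | rel_value b M t != 0%R]%classic.
Proof.
apply: sub_finite_set (finite_bounded_tuples k (maxn m n)) => t /= nz i.
suff /allP : all (fun d : posn => d <= maxn m n) t by apply; exact: mem_tnth.
move: nz; case: (tval t) => [|d [|d' [|? ?]]] //=; last by rewrite eqxx.
  rewrite andbT; case: ifP => _ /entry_neq0/andP[h1 h2]; rewrite leq_max.
    by rewrite h1.
  by rewrite h2 orbT.
by move=> /entry_neq0/andP[h1 h2]; rewrite !leq_max h1 h2 orbT.
Qed.

Section Encodings.
Variables (K : comNzSemiRingType) (S : schema) (sg : vocab).
Variable E : encoding S sg.

Lemma rel_db_one (I : instance K) : size_dim I (enc_size E COne) = pone.
Proof. by rewrite enc_one_size size_dim_one. Qed.

Definition rel_db (I : instance K) : database K :=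
  @Database K (fun c => size_dim I (enc_size E c)) (rel_db_one I)
    (fun R => KRel (rel_value_fin (mcol (enc_mat E R)) (mat I (enc_mat E R))
                      (arity R))).

Lemma mat_inst_one (db : database K) : dconst db (enc_const E One) = pone.
Proof. by rewrite enc_one dconst_one. Qed.

Definition krel_at k (r : krel K k) (t : seq posn) : K :=
  if insub t is Some t' then r t' else 0%R.

Definition ord_posn n (i : 'I_n) : posn := @PosN i.+1 isT.

(* The tuple of a relation of arity k that holds the entry (i, j) of a matrix
   of type (_, b). *)
Definition entry_tuple (k : nat) (b : size_sym) (i j : posn) : seq posn :=
  match k with
  | 0 => [::]
  | 1 => if b == One then [:: i] else [:: j]
  | _ => [:: i; j]
  end.

Definition mat_inst (db : database K) : instance K :=
  @Instance K (fun a => dconst db (enc_const E a)) (mat_inst_one db)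
    (fun A => (\matrix_(i, j) krel_at (drel db (enc_rel E A))
       (entry_tuple (arity (enc_rel E A)) (mcol A)
          (ord_posn i) (ord_posn j)))%R).

(* t lies in the range determined by the type of A and the constants of db *)
Definition in_range (db : database K) (A : mat_sym) (t : seq posn) : bool :=
  let m := dconst db (enc_const E (mrow A)) in
  let n := dconst db (enc_const E (mcol A)) in
  match t with
  | [::] => true
  | [:: i] => if mcol A == One then i <= m else i <= n
  | [:: i; j] => (i <= m) && (j <= n)
  | _ => false
  end.

(* db, as a database over the subvocabulary sg' of sg, is consistent with E *)
Definition consistent (sg' : vocab) (db : database K) : Prop :=
  {in voc_rels sg', forall R, forall t : (arity R).-tuple posn,
    drel db R t != 0%R -> in_range db (enc_mat E R) t}.

End Encodings.

(** * Well-typed formulas and queries *)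

Section Typing.
Variables (S : schema) (sg : vocab) (Mat : encoding S sg).
Local Open Scope fmap_scope.

Definition typing := {fmap var -> size_sym}.

Definition agree (t1 t2 : typing) : Prop :=
  forall x a b, t1.[? x] = Some a -> t2.[? x] = Some b -> a = b.

Fixpoint has_typing (f : formula) (t : typing) : Prop :=
  match f with
  | FAtom R xs =>
      let A := enc_mat Mat R in
      match tval xs with
      | [::] => [/\ mrow A = One, mcol A = One & t = [fmap]]
      | [:: x] => exists a, ((mrow A, mcol A) = (a, One) \/
                             (mrow A, mcol A) = (One, a)) /\
                            t = [fmap].[x <- a]
      | [:: x; y] => (x = y -> mrow A = mcol A) /\
                     t = [fmap].[x <- mrow A].[y <- mcol A]
      | _ => False
      end
  | FLe x c => t = [fmap].[x <- enc_size Mat c]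
  | FEx x g => exists2 t', has_typing g t' & t = t'.[~ x]
  | FAnd g h | FOr g h => exists t1 t2,
      [/\ has_typing g t1, has_typing h t2, agree t1 t2 & t = catf t1 t2]
  end.

Definition well_typed sg' (Q : rquery sg') : Prop :=
  let A := enc_mat Mat (rq_head Q) in
  exists2 t, has_typing (rq_body Q) t &
    match tval (rq_vars Q) with
    | [::] => mrow A = One /\ mcol A = One
    | [:: x] => exists2 a, t.[? x] = Some a &
                  (mrow A, mcol A) = (a, One) \/ (mrow A, mcol A) = (One, a)
    | [:: x; y] => t.[? x] = Some (mrow A) /\ t.[? y] = Some (mcol A)
    | _ => False
    end.
End Typing.

(** * Simulation *)

(* For MQ over S, Rel is an encoding of the whole of S(MQ); only its values on
   S matter in Rel(I). The first two clauses say that Q is over Rel(S) with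
   head Rel(H), so that both databases are over the same vocabulary. *)
Definition rel_simulates (K : comNzSemiRingType) S (MQ : mquery S) sg
    (Q : rquery sg) sg1 (Rel : encoding (mq_schema MQ) sg1) : Prop :=
  [/\ rq_vocab Q = sg1, rq_head Q = enc_rel Rel (mq_head MQ) &
    forall I : instance K,
      db_eq sg1 (rel_db Rel (mq_eval MQ I)) (rq_eval Q (rel_db Rel I))].
Arguments rel_simulates K {S} MQ {sg} Q {sg1} Rel.

Definition mat_simulates (K : comNzSemiRingType) sg (Q : rquery sg) S
    (MQ : mquery S) S1 (Mat : encoding S1 (rq_vocab Q)) : Prop :=
  [/\ mq_schema MQ = S1, mq_head MQ = enc_mat Mat (rq_head Q) &
    forall db : database K, consistent Mat sg db ->
      consistent Mat (rq_vocab Q) (rq_eval Q db) /\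
      inst_eq S1 (mat_inst Mat (rq_eval Q db)) (mq_eval MQ (mat_inst Mat db))].
Arguments mat_simulates K {sg} Q {S} MQ {S1} Mat.

(* Main.v *)
Require Import Defs.
From mathcomp Require Import all_boot all_order all_algebra.
From mathcomp Require Import finmap.
From mathcomp Require Import boolp classical_sets fsbigop.

(* A two-variable formula phi(x, y) typed by (a, b) denotes an a x b matrix:
   conjunction is the entrywise product, and quantifying y is multiplication by
   the all-ones vector. In the direction from formulas to expressions, a
   variable that is not free is padded by an outer product with all-ones. In the
   other direction, products with a vector reuse the two variables, and the only
   obstacle is that formulas have no equality, so the identity is not definable.
   But a subexpression of fc-MATLANG is either definable by a formula phi(x, y)
   or diagonal with a definable diagonal phi(x): products with vectors turn
   diagonal matrices into definable ones, and a diagonal result is output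
   through a head H(x, x). *)

Set Implicit Arguments.
Unset Strict Implicit.
Unset Printing Implicit Defensive.

Import GRing.Theory.
Local Open Scope ring_scope.

(** * Entries of matrices at positive indices *)

Lemma posn_ord n (i : posn) : (i <= n)%N -> exists i' : 'I_n, i = ord_posn i'.
Proof.
case: i => [[|i] hi] // lin; exists (Ordinal (lin : (i < n)%N)).
exact: val_inj.
Qed.

Lemma leq_pone (i : posn) : (i <= 1)%N = (i == pone).
Proof.
by apply/idP/eqP => [|->//]; case: i => [[|[|i]] hi] // _; apply: val_inj.
Qed.

(** Existential quantifiers sum over all positive integers, matrix products over ['I_n]; the two
    meet here, with indices shifted by one. *)
Lemma fsum_posn (K : comNzSemiRingType) n (F : posn -> K) :
  (forall d : posn, (n < d)%N -> F d = 0) ->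
  \sum_(d \in [set: posn]) F d = \sum_(i < n) F (ord_posn i).
Proof.
move=> F0; rewrite -(@fsbig_widen _ _ _ _ [set d : posn | (d <= n)%N]%classic) //.
  rewrite (fsbig_ord _ _ (fun k => F (@PosN k.+1 isT))).
  apply: (reindex_fsbig (fun k => @PosN k.+1 isT)); split=> [k //|k l _ _|].
    by case.
  by move=> d /= /posn_ord[i ->]; exists (i : nat) => //=.
by move=> d /= [_ /negP]; rewrite -ltnNge => /F0.
Qed.

Section Entry.
Variable K : comNzSemiRingType.

Variant entry_spec m n (M : 'M[K]_(m, n)) (i j : posn) : bool -> K -> Prop :=
| EntryIn i' j' of i = ord_posn i' & j = ord_posn j' :
    entry_spec M i j true (M i' j')
| EntryOut : entry_spec M i j false 0.

Lemma entry_ord m n (M : 'M[K]_(m, n)) i j :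
  entry M (ord_posn i) (ord_posn j) = M i j.
Proof. by rewrite /entry /= !valK. Qed.

Lemma entryP m n (M : 'M[K]_(m, n)) (i j : posn) :
  entry_spec M i j ((i <= m) && (j <= n))%N (entry M i j).
Proof.
case: (boolP ((i <= m) && (j <= n))%N) => [/andP[]|out].
  by move=> /posn_ord[i' ->] /posn_ord[j' ->]; rewrite entry_ord; constructor.
have -> : entry M i j = 0; last by constructor.
by apply/eqP; apply: contraNT out; apply: entry_neq0.
Qed.

Lemma entry_out m n (M : 'M[K]_(m, n)) (i j : posn) :
  ((i <= m) && (j <= n))%N = false -> entry M i j = 0.
Proof. by case: entryP. Qed.

Lemma entry_matrix m n (F : posn -> posn -> K) (i j : posn) :
  entry (\matrix_(i < m, j < n) F (ord_posn i) (ord_posn j)) i j =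
  if ((i <= m) && (j <= n))%N then F i j else 0.
Proof. by case: entryP => // i' j' -> ->; rewrite mxE. Qed.

Lemma entry_tr m n (M : 'M[K]_(m, n)) i j : entry M^T i j = entry M j i.
Proof.
case: (boolP ((i <= n) && (j <= m))%N) => [/andP[]|out].
  by move=> /posn_ord[i' ->] /posn_ord[j' ->]; rewrite !entry_ord mxE.
by rewrite [LHS]entry_out ?(negbTE out) // [RHS]entry_out // andbC (negbTE out).
Qed.

Lemma entry_hadamard m n (M N : 'M[K]_(m, n)) i j :
  entry (\matrix_(i, j) (M i j * N i j)) i j = entry M i j * entry N i j.
Proof.
case: (boolP ((i <= m) && (j <= n))%N) => [/andP[]|/negbTE out].
  by move=> /posn_ord[i' ->] /posn_ord[j' ->]; rewrite !entry_ord mxE.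
by rewrite [LHS]entry_out // (entry_out M out) ?mul0r ?mulr0.
Qed.

Lemma entry_scale m n c (M : 'M[K]_(m, n)) i j :
  entry (c *: M) i j = c * entry M i j.
Proof.
case: (boolP ((i <= m) && (j <= n))%N) => [/andP[]|/negbTE out].
  by move=> /posn_ord[i' ->] /posn_ord[j' ->]; rewrite !entry_ord mxE.
by rewrite [LHS]entry_out // (entry_out M out) ?mul0r ?mulr0.
Qed.

Lemma entry_const m n c (i j : posn) :
  entry (const_mx c : 'M[K]_(m, n)) i j =
  if ((i <= m) && (j <= n))%N then c else 0.
Proof. by case: entryP => // i' j' _ _; rewrite mxE. Qed.

Lemma entry_id n (i j : posn) :
  entry (1%:M : 'M[K]_n) i j = if (i <= n)%N && (i == j) then 1 else 0.
Proof.
case: (boolP ((i <= n) && (j <= n))%N) => [/andP[]|].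
  move=> /posn_ord[i' ->] /posn_ord[j' ->]; rewrite !entry_ord mxE /= ltn_ord.
  rewrite -[ord_posn _ == _]val_eqE /= eqSS val_eqE.
  by case: eqP.
move=> out; rewrite entry_out ?(negbTE out) //; case: ifP => // /andP[le /eqP e].
by move: out; rewrite -e le.
Qed.

(** Outside the dimensions one factor of each summand vanishes, so the formula covers all [i] and
    [j]. *)
Lemma entry_mulE m n p (M : 'M[K]_(m, n)) (N : 'M[K]_(n, p)) i j :
  entry (M *m N) i j =
  \sum_(k < n) entry M i (ord_posn k) * entry N (ord_posn k) j.
Proof.
case: (boolP ((i <= m) && (j <= p))%N) => [/andP[]|out].
  move=> /posn_ord[i' ->] /posn_ord[j' ->]; rewrite !entry_ord mxE.
  by apply: eq_bigr => k _; rewrite !entry_ord.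
rewrite entry_out ?(negbTE out) // big1 // => k _; move: out.
rewrite negb_and => /orP[/negbTE o|/negbTE o].
  by rewrite entry_out ?mul0r // o.
by rewrite [X in _ * X]entry_out ?mulr0 // o andbF.
Qed.

Lemma entry_mul m n p (M : 'M[K]_(m, n)) (N : 'M[K]_(n, p)) i j :
  entry (M *m N) i j = \sum_(d \in [set: posn]) entry M i d * entry N d j.
Proof.
rewrite entry_mulE (@fsum_posn _ n) // => d lt.
by rewrite entry_out ?mul0r // [(d <= n)%N]leqNgt lt andbF.
Qed.

Lemma entry_mul_outer m n p (M : 'M[K]_(m, n)) (N : 'M[K]_(n, p)) i j :
  n = 1%N -> entry (M *m N) i j = entry M i pone * entry N pone j.
Proof. by move=> n1; subst n; rewrite entry_mulE big_ord1. Qed.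

End Entry.

(** On positive integers the guard [d <= 1] is the equation [d = 1]; it lets a formula substitute
    the constant 1 for a variable. *)
Lemma fsum_pone (K : comNzSemiRingType) n (F : posn -> K) : n = 1%N ->
  \sum_(d \in [set: posn]) ((if (d <= n)%N then 1 else 0) * F d) = F pone.
Proof.
move=> ->; rewrite (@fsum_posn _ 1) => [|d]; first by rewrite big_ord1 mul1r.
by rewrite ltnNge => /negbTE->; rewrite mul0r.
Qed.

Lemma fsum_neq0 (K : comNzSemiRingType) (F : posn -> K) :
  \sum_(d \in [set: posn]) F d != 0 -> exists d, F d != 0.
Proof.
move=> nz; apply: contrapT => no; case/eqP: nz; apply: fsbig1 => d _.
by apply/eqP/negPn/negP => nzd; apply: no; exists d.
Qed.

(** * Typing by total functions *)

Definition upd (T : Type) (t : var -> T) (x : var) (a : T) : var -> T :=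
  fun y => if y == x then a else t y.

Section TotalTyping.
Variables (S : schema) (sg : vocab) (Mat : encoding S sg).
Local Open Scope fmap_scope.

(** Total typings avoid domains and agreement conditions: both sides of a conjunction share one
    function. The size guessed for a bound variable must lie in the schema, since it later indexes
    an all-ones vector. *)
Fixpoint wt (f : formula) (t : var -> size_sym) : Prop :=
  match f with
  | FAtom R xs =>
      let A := enc_mat Mat R in
      match tval xs with
      | [::] => mrow A = One /\ mcol A = One
      | [:: x] => (mrow A, mcol A) = (t x, One) \/ (mrow A, mcol A) = (One, t x)
      | [:: x; y] => mrow A = t x /\ mcol A = t y
      | _ => False
      end
  | FLe x c => enc_size Mat c = t x
  | FEx x g => exists2 a, a \in sch_sizes S & wt g (upd t x a)
  | FAnd g h | FOr g h => wt g t /\ wt h t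
  end.

Lemma eq_wt f t1 t2 : {in free_vars f, t1 =1 t2} -> wt f t1 -> wt f t2.
Proof.
elim: f t1 t2 => [R xs|x c|x g IH|g IHg h IHh|g IHg h IHh] t1 t2 /= e.
- case: (tval xs) e => [|x [|y [|z s]]] //= e; rewrite !e ?inE ?eqxx ?orbT //.
- by rewrite e ?inE.
- case=> a aS w; exists a => //; apply: IH w => y yg; rewrite /upd.
  by case: eqP => // /eqP yx; apply: e; rewrite mem_filter yx.
- by case=> w1 w2; split; [apply: IHg w1|apply: IHh w2] => x xin;
    apply: e; rewrite mem_cat xin ?orbT.
- by case=> w1 w2; split; [apply: IHg w1|apply: IHh w2] => x xin;
    apply: e; rewrite mem_cat xin ?orbT.
Qed.

(** The finite typing is the restriction of [t] to the free variables; two restrictions of one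
    function always agree. *)
Lemma wt_has_typing f t : wt f t ->
  exists2 t', has_typing Mat f t' &
    forall x, t'.[? x] = if x \in free_vars f then Some (t x) else None.
Proof.
have cat u (t1 t2 : typing) (s1 s2 : seq var) :
    (forall x, t1.[? x] = if x \in s1 then Some (u x) else None) ->
    (forall x, t2.[? x] = if x \in s2 then Some (u x) else None) ->
  agree t1 t2 /\ forall x, (catf t1 t2).[? x] =
    if x \in s1 ++ s2 then Some (u x) else None.
  move=> e1 e2; split=> [x a b|x]; first rewrite e1 e2.
    by case: ifP => // _ [<-]; case: ifP => // _ [<-].
  rewrite fnd_cat mem_cat -fndSome e1 e2.
  by case: (x \in s2); rewrite ?orbT ?orbF.
elim: f t => [R xs|x c|x g IH|g IHg h IHh|g IHg h IHh] t /=.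
- case: (tval xs) => [|x [|y [|z s]]] //=.
  + by case=> -> ->; exists [fmap] => // x; rewrite fnd_fmap0.
  + move=> w; exists [fmap].[x <- t x]; first by exists (t x).
    by move=> y; rewrite fnd_set fnd_fmap0 inE; case: eqP => // ->.
  + case=> -> ->; exists [fmap].[x <- t x].[y <- t y]; first by split=> [->|].
    move=> z; rewrite !fnd_set fnd_fmap0 !inE.
    by case: (z =P y) => [->|_]; rewrite ?orbT ?orbF //; case: eqP => [->|].
- move=> ->; exists [fmap].[x <- t x] => // y.
  by rewrite fnd_set fnd_fmap0 inE; case: eqP => // ->.
- case=> a aS /IH[t' h e]; exists t'.[~ x]; first by exists t'.
  by move=> y; rewrite fnd_rem1 mem_filter e /upd; case: eqP.
- case=> /IHg[t1 h1 e1] /IHh[t2 h2 e2]; have [ag e] := cat _ _ _ _ _ e1 e2.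
  by exists (catf t1 t2) => //; exists t1, t2.
- case=> /IHg[t1 h1 e1] /IHh[t2 h2 e2]; have [ag e] := cat _ _ _ _ _ e1 e2.
  by exists (catf t1 t2) => //; exists t1, t2.
Qed.

Lemma has_typing_sizes f t x a : form_over sg f -> has_typing Mat f t ->
  t.[? x] = Some a -> a \in sch_sizes S.
Proof.
elim: f t x a => [R xs|y c|y g IH|g IHg h IHh|g IHg h IHh] t x a /=.
- move=> /(enc_mat_in Mat) /(sch_closed) /andP[rS cS].
  case: (tval xs) => [|y [|z [|u s]]] //=.
  + by case=> _ _ ->; rewrite fnd_fmap0.
  + case=> b [[[e1 e2]|[e1 e2]] ->]; rewrite fnd_set fnd_fmap0;
      by case: eqP => // _ [<-]; rewrite -?e1 -?e2.
  + by case=> _ ->; rewrite !fnd_set fnd_fmap0; case: eqP => _;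
      [case=> <-|case: eqP => // _ [<-]].
- move=> cin ->; rewrite fnd_set fnd_fmap0; case: eqP => // _ [<-].
  exact: enc_size_in.
- move=> ov [t' ht ->]; rewrite fnd_rem1; case: eqP => //= _.
  exact: IH ov ht.
- move=> /andP[o1 o2] [t1 [t2 [h1 h2 _ ->]]]; rewrite fnd_cat.
  by case: ifP => _; [apply: IHh o2 h2|apply: IHg o1 h1].
- move=> /andP[o1 o2] [t1 [t2 [h1 h2 _ ->]]]; rewrite fnd_cat.
  by case: ifP => _; [apply: IHh o2 h2|apply: IHg o1 h1].
Qed.

Lemma has_typing_wt f t t' : form_over sg f -> has_typing Mat f t' ->
  (forall x a, t'.[? x] = Some a -> t x = a) -> wt f t.
Proof.
have cat u (t1 t2 : typing) : agree t1 t2 ->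
    (forall x a, (catf t1 t2).[? x] = Some a -> u x = a) ->
  (forall x a, t1.[? x] = Some a -> u x = a) /\
  (forall x a, t2.[? x] = Some a -> u x = a).
  move=> ag e; split=> x a xa; apply: e; rewrite fnd_cat -fndSome ?xa //.
  by case xb: (t2.[? x]) => [b|] //=; rewrite (ag x a b).
elim: f t t' => [R xs|y c|y g IH|g IHg h IHh|g IHg h IHh] t t' /=.
- move=> _; case: (tval xs) => [|x [|y [|z s]]] //=.
  + by case=> -> ->.
  + by case=> b [w ->] /(_ x b); rewrite fnd_set eqxx => ->.
  + case=> xy -> e; have := e y; rewrite fnd_set eqxx => /(_ _ erefl)->.
    have := e x; rewrite !fnd_set eqxx; case: eqP => [/xy->|_];
      by move=> /(_ _ erefl)->.
- by move=> _ -> /(_ y); rewrite fnd_set eqxx => /(_ _ erefl).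
(* A bound variable that the typing of the body omits receives size 1, which lies in every
   schema. *)
- move=> ov [t1 h1 ->] e; pose a := odflt One t1.[? y]; exists a.
    rewrite /a; case ya: (t1.[? y]) => [b|]; last exact: sch_one.
    exact: has_typing_sizes ov h1 ya.
  apply: (IH _ t1) => // x b xb; rewrite /upd; case: eqP => [xy|/eqP xy].
    by rewrite /a -xy xb.
  by apply: e; rewrite fnd_rem1 xy.
- move=> /andP[o1 o2] [t1 [t2 [h1 h2 ag ->]]] /(cat _ _ _ ag)[e1 e2].
  by split; [apply: IHg h1 e1|apply: IHh h2 e2].
- move=> /andP[o1 o2] [t1 [t2 [h1 h2 ag ->]]] /(cat _ _ _ ag)[e1 e2].
  by split; [apply: IHg h1 e1|apply: IHh h2 e2].
Qed.

End TotalTyping.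

(** * Repeated head variables; equality of vocabularies and of schemas *)

(** [val_of] reads a repeated variable at its first position, so [d] respects the repetitions
    exactly when reading the variables back returns [d]. *)
Lemma respectsE k (d : k.-tuple posn) (xs : k.-tuple var) :
  respects d xs = (map (val_of xs d) xs == d).
Proof.
have nthE (i : 'I_k) : nth pone (map (val_of xs d) xs) i =
    nth pone d (index (tnth xs i) xs).
  by rewrite (nth_map 0%N) ?size_tuple // -tnth_nth.
apply/idP/eqP => [/forallP r|e].
  apply: (@eq_from_nth _ pone); rewrite size_map !size_tuple // => i lt.
  rewrite (nthE (Ordinal lt)).
  have ilt : (index (tnth xs (Ordinal lt)) xs < k)%N.
    by rewrite -[X in (_ < X)%N](size_tuple xs) index_mem mem_tnth.
  have /forallP/(_ (Ordinal ilt)) := r (Ordinal lt).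
  rewrite [tnth xs (Ordinal ilt)](tnth_nth 0%N) /= nth_index ?mem_tnth // eqxx /=.
  by rewrite !(tnth_nth pone) => /eqP->.
apply/forallP => i; apply/forallP => j; apply/implyP => /eqP ij.
by rewrite !(tnth_nth pone) -e !nthE ij.
Qed.

Lemma disj_free_safe f : disj_free f -> safe f.
Proof. by elim: f => //= g IHg h IHh /andP[/IHg ? /IHh]. Qed.

Lemma vocab_eq (sg1 sg2 : vocab) :
  voc_consts sg1 = voc_consts sg2 -> voc_rels sg1 = voc_rels sg2 -> sg1 = sg2.
Proof.
case: sg1 sg2 => c1 r1 o1 [c2 r2 o2] /= ec er; subst; congr Vocab.
exact: bool_irrelevance.
Qed.

Lemma schema_eq (S1 S2 : schema) :
  sch_sizes S1 = sch_sizes S2 -> sch_mats S1 = sch_mats S2 -> S1 = S2.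
Proof.
case: S1 S2 => s1 m1 o1 c1 [s2 m2 o2 c2] /= es em; subst.
congr Schema; exact: Prop_irrelevance.
Qed.

(** * From fc-MATLANG to two-variable formulas *)

Section ToFormula.
Variables (K : comNzSemiRingType) (S : schema) (MQ : mquery S) (sg1 : vocab).
Variable Rel : encoding (mq_schema MQ) sg1.

(** The simulating query must live over the image of the matrix schema: the head is removed here, so
    that it is fresh, and restored by [rq_vocab]. *)
Definition body_vocab : vocab :=
  @Vocab (voc_consts sg1) (voc_rels sg1 `\ enc_rel Rel (mq_head MQ))%fset
    (voc_one sg1).
Local Notation sg := body_vocab.

(** * Closure properties of two-variable formulas *)

(** Specification of a formula by its meaning [F], so that constructions need not mention syntax.
    The variables are always 0 and 1, which bounds their number globally; [T] is a sufficient
    condition for well-typedness. *)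
Definition fo2 (xs : seq var) (T : (var -> size_sym) -> Prop)
    (F : instance K -> valuation -> K) : Prop :=
  exists f, [/\ disj_free f, {in vars f, forall x, (x < 2)%N}, form_binary f,
                form_over sg f & free_vars f =i xs] /\
    (forall t, T t -> wt Rel f t) /\
    (forall I v, sem (rel_db Rel I) f v = F I v).

Lemma fo2_weaken xs T F ys T' F' : fo2 xs T F -> xs =i ys ->
  (forall t, T' t -> T t) -> (forall I v, F I v = F' I v) -> fo2 ys T' F'.
Proof.
case=> f [[df vf bf of_ ff] [wf sf]] e eT eF; exists f; split; last first.
  by split=> [t /eT/wf //|I v]; rewrite sf eF.
by split=> // x; rewrite ff e.
Qed.

Lemma fo2_and xs T F ys T' F' : fo2 xs T F -> fo2 ys T' F' ->
  fo2 (xs ++ ys) (fun t => T t /\ T' t) (fun I v => F I v * F' I v).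
Proof.
move=> [f [[df vf bf of_ ff] [wf sf]]] [g [[dg vg bg og fg] [wg sg]]].
exists (FAnd f g) => /=; rewrite df dg bf bg of_ og; split.
  split=> // x; first by rewrite mem_cat => /orP[/vf|/vg].
  by rewrite !mem_cat ff fg.
by split=> [t [/wf ? /wg] //|I v]; rewrite sf sg.
Qed.

Lemma fo2_le x a : (x < 2)%N -> a \in sch_sizes S ->
  fo2 [:: x] (fun t => t x = a)
    (fun I v => if (v x <= size_dim I a)%N then 1 else 0).
Proof.
move=> x2 aS; exists (FLe x (enc_const Rel a)) => /=; split.
  split=> //; first by move=> y; rewrite inE => /eqP->.
  exact: (enc_const_in Rel).
by split=> [t ->|I v] /=; rewrite (enc_constK Rel).
Qed.

(** The condition [x \in xs] is what makes the semantics sum over [x]: quantifying a variable that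
    is not free leaves the value unchanged. *)
Lemma fo2_ex x a xs T F : (x < 2)%N -> x \in xs -> a \in sch_sizes S ->
  fo2 xs T F ->
  fo2 [seq y <- xs | y != x] (fun t => T (upd t x a))
    (fun I v => \sum_(d \in [set: posn]) F I (vset v x d)).
Proof.
move=> x2 xin aS [f [[df vf bf of_ ff] [wf sf]]].
exists (FEx x f) => /=; rewrite df bf of_; split.
  split=> // y; first by rewrite inE => /orP[/eqP->|/vf].
  by rewrite !mem_filter ff.
split=> [t /wf w|I v]; first by exists a.
by rewrite ff xin; apply: eq_fsbigr => d _; rewrite sf.
Qed.

Lemma size_dim1 (I : instance K) : size_dim I One = 1%N :> nat.
Proof. by rewrite size_dim_one. Qed.

Lemma leq_dim1 (I : instance K) (i : posn) :
  (i <= size_dim I One)%N = (i == pone).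
Proof. by rewrite size_dim1 leq_pone. Qed.

Lemma other_var x : (x < 2)%N -> (1 - x < 2)%N /\ (1 - x != x)%N.
Proof. by case: x => [|[]]. Qed.

(** The formula is [exists z, z <= 1 /\ phi(x, z)]; the guard leaves one term in the sum. *)
Lemma fo2_at_pone x z a F : (x < 2)%N -> (z < 2)%N -> z != x ->
  fo2 [:: x; z] (fun t => t x = a /\ t z = One) (fun I v => F I (v x) (v z)) ->
  fo2 [:: x] (fun t => t x = a) (fun I v => F I (v x) pone).
Proof.
move=> x2 z2 zx h; have le := fo2_le z2 (sch_one S).
apply: fo2_weaken (fo2_ex z2 _ (sch_one S) (fo2_and le h)) _ _ _.
- by rewrite !inE eqxx.
- by move=> y; rewrite mem_filter !inE; case: (y =P z) => [->|] //=;
    rewrite ?(negbTE zx) ?orbF.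
- by move=> t <-; rewrite /upd eqxx eq_sym (negbTE zx).
- move=> I v; rewrite /vset eqxx eq_sym (negbTE zx).
  by rewrite fsum_pone // size_dim1.
Qed.

(** * Matrix families represented by formulas *)

Definition mx_family a b := forall I : instance K,
  'M[K]_(size_dim I a, size_dim I b).

(* The formula is required for x = y as well, so that intersecting with a
   diagonal matrix needs no substitution of y by x. *)
Definition binary_rep a b (M : mx_family a b) : Prop :=
  forall x y, (x < 2)%N -> (y < 2)%N ->
  fo2 [:: x; y] (fun t => t x = a /\ t y = b)
    (fun I v => entry (M I) (v x) (v y)).

(* Formulas have no equality: a diagonal matrix is represented by the unary
   formula of its diagonal. *)
Definition diag_rep a b (M : mx_family a b) : Prop :=
  [/\ a = b,
      forall x, (x < 2)%N -> fo2 [:: x] (fun t => t x = a)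
        (fun I v => entry (M I) (v x) (v x)) &
      forall I i j, i != j -> entry (M I) i j = 0].

Definition rep a b (M : mx_family a b) := binary_rep M \/ diag_rep M.

Lemma eq_binary_rep a b (M N : mx_family a b) :
  (forall I, M I = N I) -> binary_rep M -> binary_rep N.
Proof.
by move=> e h x y x2 y2; apply: fo2_weaken (h x y x2 y2) _ _ _ => // I v;
  rewrite e.
Qed.

Lemma binary_rep_tr a b (M : mx_family a b) : binary_rep M ->
  binary_rep (fun I => (M I)^T : 'M_(size_dim I b, size_dim I a)).
Proof.
move=> h x y x2 y2; apply: fo2_weaken (h y x y2 x2) _ _ _ => [z|t []|I v] //.
  by rewrite !inE orbC.
by rewrite entry_tr.
Qed.

Lemma rep_tr a b (M : mx_family a b) : rep M ->
  rep (fun I => (M I)^T : 'M_(size_dim I b, size_dim I a)).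
Proof.
case=> [/binary_rep_tr|[e h d]]; [by left|right; split=> // [x x2|I i j]].
  by apply: fo2_weaken (h x x2) _ _ _ => [z|t|I v] //; rewrite -?e ?entry_tr.
by rewrite entry_tr eq_sym; apply: d.
Qed.

(** A diagonal matrix is square, so as a vector it is 1 by 1; the guard [y <= 1] then extends its
    diagonal formula to two variables. *)
Lemma rep_vec a b (M : mx_family a b) : vec_type a b -> rep M -> binary_rep M.
Proof.
move=> ab [//|[e h d]] x y x2 y2.
have a1 : a = One by move: ab; rewrite -e /vec_type orbb => /eqP.
have b1 : b = One by rewrite -e.
apply: fo2_weaken (fo2_and (h x x2) (fo2_le y2 (sch_one S))) _ _ _ => //.
  by move=> t []; rewrite b1.
move=> I v; rewrite leq_dim1.
case: (boolP (v x <= 1)%N) => [|vx].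
  rewrite leq_pone => /eqP->; case: eqP => [->|/eqP n]; rewrite ?mulr1 ?mulr0 //.
  by rewrite d // eq_sym.
have o j : entry (M I) (v x) j = 0.
  by apply: entry_out; rewrite [X in size_dim I X]a1 size_dim1 (negbTE vx).
by rewrite !o mul0r.
Qed.

Lemma fo2_col a b (M : mx_family a b) x : (x < 2)%N -> b = One ->
  binary_rep M ->
  fo2 [:: x] (fun t => t x = a) (fun I v => entry (M I) (v x) pone).
Proof.
move=> x2 b1 h; subst b; have [z2 zx] := other_var x2.
exact: (@fo2_at_pone x _ a (fun I => entry (M I)) x2 z2 zx (h _ _ x2 z2)).
Qed.

Lemma fo2_row a b (M : mx_family a b) y : (y < 2)%N -> a = One ->
  binary_rep M ->
  fo2 [:: y] (fun t => t y = b) (fun I v => entry (M I) pone (v y)).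
Proof.
move=> y2 a1 /binary_rep_tr/(fo2_col y2 a1) h.
by apply: fo2_weaken h _ _ _ => // I v; rewrite entry_tr.
Qed.

Lemma fo2_scalar a b (M : mx_family a b) : a = One -> b = One ->
  binary_rep M -> fo2 [::] (fun=> True) (fun I v => entry (M I) pone pone).
Proof.
move=> a1 b1 /(fo2_col (isT : (0 < 2)%N) b1) h.
have le := fo2_le (isT : (0 < 2)%N) (sch_one S).
apply: fo2_weaken (fo2_ex (isT : (0 < 2)%N) _ (sch_one S) (fo2_and le h)) _ _ _.
- by [].
- by [].
- by move=> t _; rewrite /upd.
- move=> I v; rewrite /vset eqxx.
  by rewrite (fsum_pone (fun d => entry (M I) d pone)) // size_dim1.
Qed.

(** * Closure of representability under the operations of the fragment *)

(** For a definable [M] the formula is [y <= 1 /\ exists z, M(x, z) /\ N(z)]. The bound [z] may be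
    [y] itself: the outer [y] is only compared with 1, outside the quantifier. For a diagonal [M]
    the sum has one term, which gives [M(x, x) /\ N(x, y)]. *)
Lemma binary_rep_mulmx_col a b (M : mx_family a b) (N : mx_family b One) :
  b \in sch_sizes S -> rep M -> binary_rep N ->
  binary_rep (fun I => M I *m N I : 'M_(size_dim I a, size_dim I One)).
Proof.
move=> bS [hM|[e hM dM]] hN x y x2 y2.
  have [z2 zx] := other_var x2; set z := (1 - x)%N in z2 zx.
  have zin : z \in [:: x; z] ++ [:: z] by rewrite mem_cat !inE eqxx !orbT.
  have h := fo2_ex z2 zin bS (fo2_and (hM x z x2 z2) (fo2_col z2 erefl hN)).
  apply: fo2_weaken (fo2_and (fo2_le y2 (sch_one S)) h) _ _ _.
  - move=> u; rewrite !inE !mem_filter !inE orbC; case: (u =P z) => [->|_] //=.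
      by rewrite (negbTE zx).
    by rewrite !orbF.
  - by move=> t [<- <-]; rewrite /upd eqxx eq_sym (negbTE zx).
  - move=> I v; rewrite leq_dim1; case: eqP => [->|/eqP vy].
      rewrite mul1r entry_mul; apply: eq_fsbigr => d _.
      by rewrite /vset eqxx eq_sym (negbTE zx).
    by rewrite mul0r entry_out // size_dim1 leq_pone (negbTE vy) andbF.
apply: fo2_weaken (fo2_and (hM x x2) (hN x y x2 y2)) _ _ _.
- by move=> u; rewrite !inE; case: (u == x).
- by move=> t []; rewrite -e.
move=> I v; rewrite entry_mul; apply/esym.
rewrite -(@fsbig_widen _ _ _ _ [set v x]%classic) ?fsbig_set1 // => d /= [_ dx].
by rewrite dM ?mul0r //; apply/eqP => /esym.
Qed.

(** Transposition turns this into the column case; commutativity of [K] justifies reversing the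
    product. *)
Lemma binary_rep_mulmx_row b c (M : mx_family One b) (N : mx_family b c) :
  b \in sch_sizes S -> binary_rep M -> rep N ->
  binary_rep (fun I => M I *m N I : 'M_(size_dim I One, size_dim I c)).
Proof.
move=> bS /binary_rep_tr hM /rep_tr hN.
apply: eq_binary_rep (binary_rep_tr (binary_rep_mulmx_col bS hN hM)) => I.
by rewrite trmx_mul !trmxK.
Qed.

(** The inner index is 1, so two variables suffice: [M(x, 1) /\ N(1, y)], where each conjunct reuses
    the other variable to express the constant. *)
Lemma binary_rep_outer a c (M : mx_family a One) (N : mx_family One c) :
  binary_rep M -> binary_rep N ->
  binary_rep (fun I => M I *m N I : 'M_(size_dim I a, size_dim I c)).
Proof.
move=> hM hN x y x2 y2.
apply: fo2_weaken (fo2_and (fo2_col x2 erefl hM) (fo2_row y2 erefl hN)) _ _ _ => // I v.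
by rewrite entry_mul_outer // size_dim1.
Qed.

(** Size 1 occurs as [a], [b] or [c]: at [b] the product is an outer one, otherwise a row times a
    matrix or a matrix times a column. The result is always definable, even from a diagonal
    factor. *)
Lemma rep_mulmx a b c (M : mx_family a b) (N : mx_family b c) :
  b \in sch_sizes S -> vec_type a b || vec_type b c -> rep M -> rep N ->
  binary_rep (fun I => M I *m N I : 'M_(size_dim I a, size_dim I c)).
Proof.
move=> bS vec hM hN; case: (eqVneq b One) vec => [b1 _|b1].
  subst b; apply: binary_rep_outer; apply: rep_vec => //; rewrite /vec_type eqxx //.
  by rewrite orbT.
rewrite /vec_type (negbTE b1) /= orbF => /orP[] /eqP e; subst.
  by apply: binary_rep_mulmx_row => //; apply: rep_vec hM.
by apply: binary_rep_mulmx_col => //; apply: rep_vec hN; rewrite /vec_type orbT.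
Qed.

(** One diagonal factor makes the product diagonal, with [phi(x) /\ psi(x, x)] on the diagonal when
    the other is definable. A diagonal right factor is moved to the left by commutativity. *)
Lemma rep_hadamard a b (M N : mx_family a b) : rep M -> rep N ->
  rep (fun I => \matrix_(i, j) (M I i j * N I i j)).
Proof.
have diag (M' N' : mx_family a b) : diag_rep M' -> rep N' ->
    diag_rep (fun I => \matrix_(i, j) (M' I i j * N' I i j)).
  move=> [e hM dM] hN; split=> // [x x2|I i j ij]; last first.
    by rewrite entry_hadamard dM // mul0r.
  have {}hN : fo2 [:: x] (fun t => t x = a) (fun I v => entry (N' I) (v x) (v x)).
    case: hN => [hN|[_ hN _]]; last exact: hN.
    by apply: fo2_weaken (hN x x x2 x2) _ _ _ => // [y|t]; rewrite -?e // !inE orbb.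
  apply: fo2_weaken (fo2_and (hM x x2) hN) _ _ _ => // [y|I v].
    by rewrite !inE orbb.
  by rewrite entry_hadamard.
move=> [hM|hM] hN; last by right; apply: diag.
case: hN => [hN|hN].
  left=> x y x2 y2.
  apply: fo2_weaken (fo2_and (hM x y x2 y2) (hN x y x2 y2)) _ _ _ => // [u|I v].
    by rewrite mem_cat orbb.
  by rewrite entry_hadamard.
right; case: (diag N M hN (or_introl hM)) => e h d; split=> // [x x2|I i j ij].
  apply: fo2_weaken (h x x2) _ _ _ => // I v.
  by rewrite !entry_hadamard mulrC.
by have := d I i j ij; rewrite !entry_hadamard mulrC.
Qed.

Lemma rep_scale a b (s : mx_family One One) (M : mx_family a b) :
  rep s -> rep M -> rep (fun I => entry (s I) pone pone *: M I).
Proof.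
move=> /(rep_vec (isT : vec_type One One)) /(fo2_scalar erefl erefl) hs.
move=> [hM|[e hM dM]].
  left=> x y x2 y2.
  apply: fo2_weaken (fo2_and hs (hM x y x2 y2)) _ _ _ => // I v.
  by rewrite entry_scale.
right; split=> // [x x2|I i j ij]; last by rewrite entry_scale dM // mulr0.
apply: fo2_weaken (fo2_and hs (hM x x2)) _ _ _ => // I v.
by rewrite entry_scale.
Qed.

(** * Matrix symbols and the induction on expressions *)

Lemma enc_rel_body A : A \in sch_mats S ->
  enc_rel Rel A \in voc_rels sg /\ enc_mat Rel (enc_rel Rel A) = A.
Proof.
move=> AS; have AS1 : A \in sch_mats (mq_schema MQ) by rewrite !inE AS orbT.
have HS1 : mq_head MQ \in sch_mats (mq_schema MQ) by rewrite !inE eqxx.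
split; last exact: enc_relK.
rewrite !inE (enc_rel_in Rel AS1) andbT; apply/eqP => e.
have := enc_relK Rel AS1; rewrite e (enc_relK Rel HS1) => e'.
by move: (mq_fresh MQ); rewrite e' AS.
Qed.

Lemma fo2_atom R xs : R \in voc_rels sg -> {in tval xs, forall x, (x < 2)%N} ->
  fo2 xs (wt Rel (FAtom (R := R) xs))
    (fun I v => rel_value (mcol (enc_mat Rel R)) (mat I (enc_mat Rel R))
      (map v xs)).
Proof.
move=> RS x2; exists (FAtom xs); split; last by [].
split=> //=; apply: (enc_arity Rel); by move: RS; rewrite !inE => /andP[].
Qed.

Lemma entry_row1 a b (M : mx_family a b) I i j :
  a = One -> i != pone -> entry (M I) i j = 0.
Proof.
move=> a1 i1; apply: entry_out; rewrite [X in size_dim I X]a1 leq_dim1.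
by rewrite (negbTE i1).
Qed.

Lemma entry_col1 a b (M : mx_family a b) I i j :
  b = One -> j != pone -> entry (M I) i j = 0.
Proof.
move=> b1 j1; apply: entry_out; rewrite andbC [X in size_dim I X]b1 leq_dim1.
by rewrite (negbTE j1).
Qed.

(** A relation of arity below 2 leaves out an index that is constantly 1; the guards [x <= 1] and
    [y <= 1] supply the missing free variables and the zeros elsewhere. *)
Lemma rep_mat A : A \in sch_mats S -> binary_rep (fun I => mat I A).
Proof.
move=> AS x y x2 y2; have [RS e] := enc_rel_body AS.
have RS1 : enc_rel Rel A \in voc_rels sg1 by move: RS; rewrite !inE => /andP[].
have lex := fo2_le x2 (sch_one S); have ley := fo2_le y2 (sch_one S).
have := enc_arity Rel RS1; have := enc_unary Rel RS1; have := enc_nullary Rel RS1.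
have row1 := @entry_row1 _ _ (fun I => mat I A).
have col1 := @entry_col1 _ _ (fun I => mat I A).
have := @fo2_atom (enc_rel Rel A) _ RS; rewrite /= e.
case: (arity (enc_rel Rel A)) => [|[|[|]]] // atom null un _.
- have [//|r1 c1] := null; have {}atom := atom [tuple] (fun _ h => ltac:(done)).
  apply: fo2_weaken (fo2_and atom (fo2_and lex ley)) _ _ _ => //.
    by move=> t [tx ty] /=; rewrite tx ty.
  move=> I v; rewrite !leq_dim1.
  case: (eqVneq (v x) pone) => [->|n]; last by rewrite mul0r mulr0 row1.
  case: (eqVneq (v y) pone) => [->|n]; last by rewrite !mulr0 col1.
  by rewrite !mulr1.
(* A unary relation of type (1, 1) is read as a column, as in [rel_value]. *)
- case: (eqVneq (mcol A) One) => [c1|c1].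
    have {}atom := atom [tuple x] _.
    apply: fo2_weaken (fo2_and (atom _) ley) _ _ _ => //.
    + by move=> z; rewrite inE => /eqP->.
    + by move=> t [tx ty] /=; rewrite tx ty c1; split=> //; left.
    + move=> I v /=; rewrite leq_dim1 (introT eqP c1).
      case: (eqVneq (v y) pone) => [->|n]; last by rewrite mulr0 col1.
      by rewrite mulr1.
  have r1 : mrow A = One.
    by have := un erefl; rewrite /vec_type (negbTE c1) orbF => /eqP.
  have {}atom := atom [tuple y] _.
  apply: fo2_weaken (fo2_and lex (atom _)) _ _ _ => //.
  + by move=> z; rewrite inE => /eqP->.
  + by move=> t [tx ty] /=; rewrite tx ty r1; split=> //; right.
  + move=> I v /=; rewrite leq_dim1 (negbTE c1).
    case: (eqVneq (v x) pone) => [->|n]; last by rewrite mul0r row1.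
    by rewrite mul1r.
- apply: fo2_weaken (atom [tuple x; y] _) _ _ _ => //.
    by move=> z; rewrite !inE => /orP[] /eqP->.
  by move=> t [].
Qed.

(** The identity is the only source of diagonal representations; sums are excluded by [is_fc]. *)
Lemma fc_rep a b (e : expr a b) : is_fc e -> expr_over S e ->
  rep (fun I => eval I e).
Proof.
elim: e => {a b}
  [A|a b e IH|a b c e1 IH1 e2 IH2|//|a b e1 IH1 e2 IH2
  |a b e1 IH1 e2 IH2|a|a] /=.
- by move=> _ AS; left; apply: rep_mat.
- by move=> fc ov; apply: rep_tr; apply: IH.
- move=> /and3P[fc1 fc2 vec] /andP[ov1 ov2]; left; apply: rep_mulmx => //.
  + by have /andP[] := expr_over_type ov1.
  + exact: IH1.
  + exact: IH2.
- move=> /andP[fc1 fc2] /andP[ov1 ov2].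
  by apply: rep_scale; [apply: IH1|apply: IH2].
- move=> /andP[fc1 fc2] /andP[ov1 ov2].
  by apply: rep_hadamard; [apply: IH1|apply: IH2].
- move=> _ aS; left=> x y x2 y2.
  apply: fo2_weaken (fo2_and (fo2_le x2 aS) (fo2_le y2 (sch_one S))) _ _ _ => //.
  move=> I v; rewrite entry_const.
  by case: ifP => _; rewrite ?mul1r ?mul0r.
- move=> _ aS; right; split=> // [x x2|I i j ij].
    by apply: fo2_weaken (fo2_le x2 aS) _ _ _ => // I v; rewrite entry_id eqxx andbT.
  by rewrite entry_id (negbTE ij) andbF.
Qed.

(** * From represented bodies to queries *)

Lemma body_vocab_head :
  (enc_rel Rel (mq_head MQ) |` voc_rels body_vocab)%fset = voc_rels sg1.
Proof.
apply: fsetD1K; apply: (enc_rel_in Rel).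
by rewrite !inE eqxx.
Qed.

(** The last hypothesis says pointwise that the encoded matrix is the value of the query, with the
    test for repetitions in the form given by [respectsE]. *)
Lemma fo2_query (xs : (arity (enc_rel Rel (mq_head MQ))).-tuple var) T F t :
  fo2 xs T F -> T t -> wt Rel (FAtom xs) t ->
  (forall I d, size d = arity (enc_rel Rel (mq_head MQ)) ->
    rel_value (mcol (mq_head MQ)) (eval I (mq_body MQ)) d =
    let v x := nth pone d (index x xs) in
    if map v xs == d then F I v else 0) ->
  exists (sg : vocab) (Q : rquery sg),
    [/\ is_FO2_conj Q, rel_simulates K MQ Q Rel & well_typed Rel Q].
Proof.
move=> [f [[df vf bf of_ ff] [wf sf]]] Tt wxs val.
set h := enc_rel Rel (mq_head MQ) in xs ff val wxs.
have HS1 : mq_head MQ \in sch_mats (mq_schema MQ) by rewrite !inE eqxx.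
have hS1 : h \in voc_rels sg1 := enc_rel_in Rel HS1.
have hK : enc_mat Rel h = mq_head MQ := enc_relK Rel HS1.
have fresh : h \notin voc_rels body_vocab by rewrite !inE eqxx.
have ff' : xs =i free_vars f by move=> x; rewrite ff.
exists body_vocab, (RQuery fresh of_ (disj_free_safe df) ff'); split.
- rewrite /is_FO2_conj /= df bf (enc_arity Rel hS1) !andbT /=.
  apply: (@uniq_leq_size _ _ [:: 0; 1]%N); first exact: undup_uniq.
  by move=> x; rewrite mem_undup => /vf; case: x => [|[]].
- split=> //; first by apply: vocab_eq => //; exact: body_vocab_head.
  move=> I; split=> // R RS1 d /=.
  case: (eqVneq R h) => [e|ne].
    move: d; rewrite e => d; rewrite dfwith_in /= /rq_fun respectsE /= hK dfwith_in.
    rewrite val ?size_tuple //=.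
    by case: ifP => // _; rewrite sf.
  rewrite [in RHS]dfwith_out 1?eq_sym //= dfwith_out //.
  apply/eqP => e; move: ne; rewrite -(enc_matK Rel RS1) -e /h eqxx //.
- rewrite /well_typed /=.
  have [t' ht' et'] := wt_has_typing (wf _ Tt); exists t' => //.
  move: wxs ff => /=; case: (tval xs) => [|x [|y [|]]] //=.
  + by move=> w fe; exists (t x); rewrite ?et' ?fe ?inE ?eqxx.
  + by case=> -> -> fe; rewrite !et' !fe !inE !eqxx orbT.
Qed.

Lemma fc_to_fo2 : is_fc_query MQ ->
  exists (sg : vocab) (Q : rquery sg),
    [/\ is_FO2_conj Q, rel_simulates K MQ Q Rel & well_typed Rel Q].
Proof.
move=> fc; have hrep := fc_rep fc (mq_over MQ).
have HS1 : mq_head MQ \in sch_mats (mq_schema MQ) by rewrite !inE eqxx.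
have hS1 := enc_rel_in Rel HS1.
have := enc_arity Rel hS1; have := enc_unary Rel hS1; have := enc_nullary Rel hS1.
have := @fo2_query; rewrite /= (enc_relK Rel HS1).
case: (arity (enc_rel Rel (mq_head MQ))) => [|[|[|]]] // query null un _.
- have [//|r1 c1] := null.
  have bin : binary_rep (fun I => eval I (mq_body MQ)).
    by apply: rep_vec hrep; rewrite /vec_type r1.
  apply: (query [tuple] _ _ (fun=> One) (fo2_scalar r1 c1 bin)) => //= I.
  by case.
- have bin := rep_vec (un erefl) hrep.
  case: (eqVneq (mcol (mq_head MQ)) One) => [c1|c1].
    apply: (query [tuple 0%N] _ _ (fun=> mrow (mq_head MQ))
      (@fo2_col _ _ _ 0%N isT c1 bin)) => //=.
      by left; rewrite c1.
    move=> I [|i []] //= _.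
    by rewrite eqxx (introT eqP c1).
  have r1 : mrow (mq_head MQ) = One.
    by have := un erefl; rewrite /vec_type (negbTE c1) orbF => /eqP.
  apply: (query [tuple 0%N] _ _ (fun=> mcol (mq_head MQ))
    (@fo2_row _ _ _ 0%N isT r1 bin)) => //=.
    by right; rewrite r1.
  move=> I [|i []] //= _.
  by rewrite eqxx (negbTE c1).
- case: hrep => [bin|[e h d]].
    apply: (query [tuple 0%N; 1%N] _ _
      (fun x => if x == 0%N then mrow (mq_head MQ) else mcol (mq_head MQ))
      (bin 0%N 1%N isT isT)) => //=.
    by move=> I [|i [|j []]] //= _; rewrite eqxx.
  (* Diagonal case: the head repeats one variable, which yields zero off the diagonal without an
     equality in the body. *)
  apply: (query [tuple 0%N; 0%N] _ _ (fun=> mrow (mq_head MQ))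
    (fo2_weaken (h 0%N isT) _ (fun _ => id) (fun _ _ => erefl))) => //=.
    by move=> x; rewrite !inE orbb.
  move=> I [|i [|j []]] //= _; rewrite eqseq_cons eqxx /= eqseq_cons andbT.
  by case: eqVneq => [->|/d].
Qed.

End ToFormula.

(** * From two-variable formulas to fc-MATLANG *)

(** If [s] has no second variable, a fresh one is taken; a third one would give three distinct
    elements of [x :: s]. *)
Lemma two_vars_cover (s : seq var) x : (size (undup (x :: s)) <= 2)%N ->
  exists2 y, y != x & {subset s <= [:: x; y]}.
Proof.
move=> s2; have sub z : z \in s -> z != x -> z \in [seq z <- s | z != x].
  by move=> zs zx; rewrite mem_filter zx.
case e : [seq z <- s | z != x] sub => [|y r] sub.
  exists x.+1; first by rewrite neq_ltn ltnSn orbT.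
  move=> z zs; rewrite inE; case: eqVneq => // zx.
  by have := sub z zs zx.
have : y \in [seq z <- s | z != x] by rewrite e inE eqxx.
rewrite mem_filter => /andP[yx ys]; exists y => // z zs; rewrite !inE.
case: eqVneq => //= zx; apply: contraTT s2 => zy; rewrite -ltnNge.
apply: (@uniq_leq_size _ [:: x; y; z]).
  by rewrite /= !inE negb_or eq_sym yx eq_sym zx eq_sym zy.
move=> u; rewrite mem_undup !inE => /or3P[] /eqP->; rewrite ?eqxx //.
  by rewrite ys orbT.
by rewrite zs orbT.
Qed.

Lemma free_vars_sub f : {subset free_vars f <= vars f}.
Proof.
elim: f => [R xs|x c|x g IH|g IHg h IHh|g IHg h IHh] y //=.
- by rewrite mem_filter inE => /andP[_ /IH->]; rewrite orbT.
- by rewrite !mem_cat => /orP[/IHg->|/IHh->]; rewrite ?orbT.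
- by rewrite !mem_cat => /orP[/IHg->|/IHh->]; rewrite ?orbT.
Qed.

Section ToExpr.
Variables (K : comNzSemiRingType) (sg : vocab) (Q : rquery sg) (S1 : schema).
Variable Mat : encoding S1 (rq_vocab Q).
Local Notation H := (enc_mat Mat (rq_head Q)).

Lemma body_schema_closed : {in (sch_mats S1 `\ H)%fset, forall A,
  (mrow A \in sch_sizes S1) && (mcol A \in sch_sizes S1)}.
Proof. by move=> A; rewrite !inE => /andP[_]; apply: sch_closed. Qed.

Definition body_schema : schema := Schema (sch_one S1) body_schema_closed.
Local Notation S := body_schema.
Local Notation dim db a := (dconst db (enc_const Mat a)).

(** * Values and ranges over the encoded instance *)

Lemma enc_mat_body R : R \in voc_rels sg ->
  enc_mat Mat R \in sch_mats S /\ enc_rel Mat (enc_mat Mat R) = R.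
Proof.
move=> RS; have RS1 : R \in voc_rels (rq_vocab Q) by rewrite !inE RS orbT.
have HS1 : rq_head Q \in voc_rels (rq_vocab Q) by rewrite !inE eqxx.
split; last exact: enc_matK.
rewrite !inE (enc_mat_in Mat RS1) andbT; apply/eqP => e.
have := enc_matK Mat RS1; rewrite e (enc_matK Mat HS1) => e'.
by move: (rq_fresh Q); rewrite e' RS.
Qed.

Lemma krel_atE k (r : krel K k) (t : k.-tuple posn) : krel_at r t = r t.
Proof. by rewrite /krel_at valK. Qed.

Lemma sem_atom (db : database K) R (xs : (arity R).-tuple var) v :
  sem db (FAtom xs) v = krel_at (drel db R) (map v xs).
Proof. exact/esym/(krel_atE (drel db R) (map_tuple v xs)). Qed.

Lemma entry_mat_inst (db : database K) A (i j : posn) :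
  entry (mat (mat_inst Mat db) A) i j =
  if ((i <= dim db (mrow A)) && (j <= dim db (mcol A)))%N
  then krel_at (drel db (enc_rel Mat A))
         (entry_tuple (arity (enc_rel Mat A)) (mcol A) i j)
  else 0.
Proof.
exact: (entry_matrix _ _ (fun i j => krel_at (drel db (enc_rel Mat A))
         (entry_tuple (arity (enc_rel Mat A)) (mcol A) i j))).
Qed.

Lemma entry_mat_body (db : database K) R (i j : posn) : R \in voc_rels sg ->
  entry (mat (mat_inst Mat db) (enc_mat Mat R)) i j =
  if ((i <= dim db (mrow (enc_mat Mat R))) &&
      (j <= dim db (mcol (enc_mat Mat R))))%N
  then krel_at (drel db R) (entry_tuple (arity R) (mcol (enc_mat Mat R)) i j)
  else 0.
Proof. by move=> /enc_mat_body[_ e]; rewrite entry_mat_inst e. Qed.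

(** A non-zero product has non-zero factors and a non-zero sum a non-zero term, so the claim
    descends to the atoms, where it is consistency or the guard itself. It bounds the sum of a
    quantifier by a dimension and keeps the output consistent. *)
Lemma sem_range (db : database K) f t v : consistent Mat sg db ->
  disj_free f -> form_over sg f -> wt Mat f t -> sem db f v != 0 ->
  {in free_vars f, forall x, (v x <= dim db (t x))%N}.
Proof.
move=> cons; elim: f t v => [R xs|x c|x g IH|g IHg h IHh|//] t v /=.
- move=> _ RS w /(cons _ RS) /=; case: (tval xs) w => [|x [|y [|]]] //=.
  + move=> w r z; rewrite inE => /eqP->; move: r.
    case: w => [] [-> ->]; first by rewrite eqxx.
    by case: eqP => // ->.
  + by case=> -> -> /andP[rx ry] z; rewrite !inE => /orP[] /eqP->.
- move=> _ cS e; case: ifP; last by rewrite eqxx.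
  by move=> le _ y; rewrite inE => /eqP->; rewrite -e (enc_sizeK Mat).
- move=> dg og [a aS w]; case: ifP => xg nz y; rewrite mem_filter => /andP[yx yg].
    have [d nzd] := fsum_neq0 nz.
    by have := IH _ _ dg og w nzd _ yg; rewrite /upd /vset (negbTE yx).
  by have := IH _ _ dg og w nz _ yg; rewrite /upd (negbTE yx).
- move=> /andP[dg dh] /andP[og oh] [wg wh] nz x; rewrite mem_cat => /orP[xg|xh].
    apply: IHg wg _ _ xg => //; apply: contra nz => /eqP->.
    by rewrite mul0r.
  apply: IHh wh _ _ xh => //; apply: contra nz => /eqP->.
  by rewrite mulr0.
Qed.

(* A variable among x, y that is not free in f still has a size: its dimension
   is filled with copies. *)
Definition mx_translatable f x y a b := exists e : expr a b,
  [/\ is_fc e, expr_over S e & forall db : database K, consistent Mat sg db ->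
    forall v : valuation, (v x <= dim db a)%N -> (v y <= dim db b)%N ->
    sem db f v = entry (eval (mat_inst Mat db) e) (v x) (v y)].

Definition col_translatable f x a := exists e : expr a One,
  [/\ is_fc e, expr_over S e & forall db : database K, consistent Mat sg db ->
    forall v : valuation, (v x <= dim db a)%N ->
    sem db f v = entry (eval (mat_inst Mat db) e) (v x) pone].

Lemma mx_translatable_sym f x y a b :
  mx_translatable f x y a b -> mx_translatable f y x b a.
Proof.
move=> [e [fc ov h]]; exists (ETr e); split=> // db cons v vy vx /=.
by rewrite entry_tr; apply: h.
Qed.

Lemma dim1 (db : database K) : dim db One = 1%N :> nat.
Proof. by rewrite enc_one dconst_one. Qed.

Lemma posn_gt0 (i : posn) : (0 < i)%N.
Proof. by case: i. Qed.

(** * Translation of atoms, quantifiers and formulas *)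

(** The outer product with a row of ones copies the column along [y]. *)
Lemma col_translatable_mx f x y a b : b \in sch_sizes S1 ->
  col_translatable f x a -> mx_translatable f x y a b.
Proof.
move=> bS [e [fc ov h]]; exists (EMul e (ETr (EOnes b))); split.
- by rewrite /= fc /vec_type eqxx orbT.
- by rewrite /= ov bS.
move=> db cons v vx vy; rewrite (h _ cons) //=.
rewrite entry_mul_outer ?dim1 // entry_tr entry_const vy /=.
by rewrite posn_gt0 mulr1.
Qed.

(** Sizes become variables related by equations, so typing equations can be used without casting
    expressions. *)
Lemma mat_expr A a b : mrow A = a -> mcol A = b -> A \in sch_mats S ->
  exists e : expr a b, [/\ is_fc e, expr_over S e & forall (I : instance K) i j,
    entry (eval I e) i j = entry (mat I A) i j].
Proof. by move=> <- <- AS; exists (EMat A). Qed.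

Lemma id_expr a b : a = b -> a \in sch_sizes S ->
  exists e : expr a b, [/\ is_fc e, expr_over S e & forall (I : instance K) i j,
    entry (eval I e) i j =
      if (i <= size_dim I a)%N && (i == j) then 1 else 0].
Proof.
by move=> <- aS; exists (EId a); split=> // I i j; rewrite -entry_id.
Qed.

(** Vanishing beyond the dimension of [c] cuts the sum over all positive integers down to a product
    with all-ones. *)
Lemma col_translatable_ex g x y a c : x != y -> y \in free_vars g ->
  c \in sch_sizes S1 ->
  (forall (db : database K) (v : valuation), consistent Mat sg db ->
    (dim db c < v y)%N -> sem db g v = 0) ->
  mx_translatable g x y a c -> col_translatable (FEx y g) x a.
Proof.
move=> xy yg cS rg [e [fc ov h]]; exists (EMul e (EOnes c)); split.
- by rewrite /= fc /vec_type eqxx !orbT.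
- by rewrite /= ov cS.
move=> db cons v vx /=; rewrite yg entry_mulE (@fsum_posn _ (dim db c)).
  apply: eq_bigr => k _; rewrite entry_const /= ltn_ord posn_gt0 mulr1.
  by rewrite (h _ cons) /vset ?eqxx ?(negbTE xy) //=.
by move=> d lt; apply: rg => //; rewrite /vset eqxx.
Qed.

Lemma col_translatable_atom1 R (xs : (arity R).-tuple var) x t :
  R \in voc_rels sg -> tval xs = [:: x] -> wt Mat (FAtom xs) t ->
  col_translatable (FAtom xs) x (t x).
Proof.
move=> RS exs; rewrite /= exs => w; have [AS _] := enc_mat_body RS.
have k1 : arity R = 1%N by rewrite -(size_tuple xs) exs.
have semE (db : database K) v :
    sem db (FAtom xs) v = krel_at (drel db R) [:: v x].
  by rewrite -[LHS]/(sem db (FAtom xs) v) sem_atom exs.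
(* Type (1, 1) fits both typings; [entry_tuple] treats it as a column, so it is put in the first
   case. *)
have {w} [[r c]|[c1 r c]] :
    (mrow (enc_mat Mat R) = t x /\ mcol (enc_mat Mat R) = One) \/
    [/\ mcol (enc_mat Mat R) != One, mrow (enc_mat Mat R) = One &
        mcol (enc_mat Mat R) = t x].
  case: w => [] [r c]; first by left.
  case: (eqVneq (mcol (enc_mat Mat R)) One) => [e|ne]; last by right.
  by left; rewrite r -c e.
- have [e [fc ov h]] := mat_expr r c AS; exists e; split=> // db cons v vx.
  by rewrite semE h entry_mat_body // r c vx posn_gt0 /= [X in entry_tuple X]k1.
- have [e [fc ov h]] := mat_expr r c AS; exists (ETr e); split=> // db cons v vx.
  rewrite semE [RHS]entry_tr h entry_mat_body //.
  by rewrite [X in entry_tuple X]k1 /= (negbTE c1) r c posn_gt0 vx.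
Qed.

(** [R(x, x)] is the diagonal: the identity masks the matrix entrywise, and multiplying by all-ones
    sums each row to its diagonal entry. *)
Lemma col_translatable_diag R (xs : (arity R).-tuple var) x t :
  t x \in sch_sizes S1 ->
  R \in voc_rels sg -> tval xs = [:: x; x] -> wt Mat (FAtom xs) t ->
  col_translatable (FAtom xs) x (t x).
Proof.
move=> xS RS exs; rewrite /= exs => -[r c]; have [AS _] := enc_mat_body RS.
have k2 : arity R = 2%N by rewrite -(size_tuple xs) exs.
have [e [fc ov h]] := mat_expr r c AS.
exists (EMul (EHad e (EId (t x))) (EOnes (t x))); split=> /=.
- by rewrite fc /vec_type eqxx !orbT.
- by rewrite ov xS.
move=> db cons v vx; rewrite entry_mul.
have -> : drel db R (map_tuple v xs) = krel_at (drel db R) [:: v x; v x].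
  by rewrite -[LHS]/(sem db (FAtom xs) v) sem_atom exs.
rewrite -(@fsbig_widen _ _ _ _ [set v x]%classic) ?fsbig_set1 //; last first.
  move=> d /= [_ /eqP dx]; rewrite entry_hadamard entry_id [v x == d]eq_sym.
  by rewrite (negbTE dx) andbF mulr0 mul0r.
rewrite entry_hadamard (h (mat_inst Mat db)) entry_id eqxx entry_const.
rewrite vx posn_gt0 /= !mulr1.
by rewrite entry_mat_body // [X in entry_tuple X]k2 /= r c vx.
Qed.

Lemma mx_translatable_atom2 R (xs : (arity R).-tuple var) x y t :
  R \in voc_rels sg -> tval xs = [:: x; y] -> wt Mat (FAtom xs) t ->
  mx_translatable (FAtom xs) x y (t x) (t y).
Proof.
move=> RS exs; rewrite /= exs => -[r c]; have [AS _] := enc_mat_body RS.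
have k2 : arity R = 2%N by rewrite -(size_tuple xs) exs.
have [e [fc ov h]] := mat_expr r c AS; exists e; split=> // db cons v vx vy.
rewrite h entry_mat_body // r c vx vy [X in entry_tuple X]k2 /=.
by rewrite -[LHS]/(sem db (FAtom xs) v) sem_atom exs.
Qed.

Lemma mx_translatable_atom0 R (xs : (arity R).-tuple var) x y a b :
  a \in sch_sizes S1 -> b \in sch_sizes S1 ->
  R \in voc_rels sg -> tval xs = [::] ->
  mrow (enc_mat Mat R) = One -> mcol (enc_mat Mat R) = One ->
  mx_translatable (FAtom xs) x y a b.
Proof.
move=> aS bS RS exs r c; have [AS _] := enc_mat_body RS.
have k0 : arity R = 0%N by rewrite -(size_tuple xs) exs.
have [e [fc ov h]] := mat_expr r c AS; apply: col_translatable_mx bS _.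
exists (EScal e (EOnes a)); split=> /=; rewrite ?fc ?ov //.
move=> db cons v vx; rewrite (h (mat_inst Mat db)) entry_mat_body //.
rewrite r c !posn_gt0 [X in entry_tuple X]k0 /=.
rewrite entry_scale entry_const vx posn_gt0 /= mulr1.
by rewrite -[LHS]/(sem db (FAtom xs) v) sem_atom exs.
Qed.

(** Both variables carry sizes even when they are not free, and [t] is generalised because a
    quantifier may reuse [x] or [y] with another size. *)
Lemma translate f x y t : x != y -> {subset vars f <= [:: x; y]} ->
  disj_free f -> form_over sg f -> wt Mat f t ->
  t x \in sch_sizes S1 -> t y \in sch_sizes S1 ->
  mx_translatable f x y (t x) (t y).
Proof.
move=> xy; elim: f t => [R xs|z c|z g IH|g IHg h IHh|//] t sub df of_ w xS yS.
- have col z : z \in [:: x; y] -> col_translatable (FAtom xs) z (t z) ->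
      mx_translatable (FAtom xs) x y (t x) (t y).
    rewrite !inE => /orP[] /eqP-> h; first exact: col_translatable_mx.
    by apply: mx_translatable_sym; apply: col_translatable_mx.
  move: sub => /=; case exs: (tval xs) => [|z [|u [|]]] sub.
  + by move: w; rewrite /= exs => -[r c]; apply: mx_translatable_atom0.
  + apply: (col z); first by apply: sub; rewrite inE.
    exact: col_translatable_atom1 exs w.
  + have := sub z; have := sub u; rewrite !inE !eqxx orbT => /(_ isT) uxy /(_ isT).
    case: (eqVneq z u) => [zu|zu] zxy.
      apply: (col z); first by rewrite !inE.
      rewrite -zu in exs; apply: col_translatable_diag exs w => //.
      by case/orP: zxy => /eqP->.
    case/orP: zxy => /eqP zE; case/orP: uxy => /eqP uE; subst z u.
    * by rewrite eqxx in zu.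
    * exact: mx_translatable_atom2 exs w.
    * by apply: mx_translatable_sym; apply: mx_translatable_atom2 exs w.
    * by rewrite eqxx in zu.
  + by move: w; rewrite /= exs.
- have col : col_translatable (FLe z c) z (t z).
    move: w of_ => /= <- cS; exists (EOnes (enc_size Mat c)); split=> //=.
      exact: (enc_size_in Mat).
    move=> db cons v; rewrite (enc_sizeK Mat) // => vz.
    by rewrite vz entry_const vz posn_gt0.
  have := sub z; rewrite !inE eqxx => /(_ isT) /orP[] /eqP e; subst z.
    exact: col_translatable_mx.
  by apply: mx_translatable_sym; apply: col_translatable_mx.
- move: df of_ w => /= df of_ [a aS w].
  have subg : {subset vars g <= [:: x; y]}.
    by move=> u ug; apply: sub; rewrite inE ug orbT.
  case: (boolP (z \in free_vars g)) => zg; last first.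
    (* The quantifier does not sum here, so the body is translated under the original sizes. *)
    have [|e [fc ov h]] := IH t subg df of_ _ xS yS.
      apply: eq_wt w => u ug; rewrite /upd; case: eqP => // uz.
      by rewrite -uz ug in zg.
    by exists e; split=> //= db cons v vx vy; rewrite (negbTE zg); apply: h.
  have rg (db : database K) (v : valuation) : consistent Mat sg db ->
      (dim db a < v z)%N -> sem db g v = 0.
    move=> cons lt; apply/eqP; apply: contraTT lt => nz; rewrite -leqNgt.
    by have := sem_range cons df of_ w nz zg; rewrite /upd eqxx.
  (* The body is translated with [z] of size [a]; once quantified, [z] is no longer free and is
     padded to its outer size [t z]. *)
  have := IH (upd t z a) subg df of_ w; rewrite /upd.
  have := sub z; rewrite !inE eqxx => /(_ isT) /orP[] /eqP e; subst z.
    rewrite eqxx eq_sym (negbTE xy) => /(_ aS yS) /mx_translatable_sym h.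
    apply: mx_translatable_sym; apply: col_translatable_mx => //.
    by apply: col_translatable_ex rg h => //; rewrite eq_sym.
  rewrite eqxx (negbTE xy) => /(_ xS aS) h.
  apply: col_translatable_mx => //.
  exact: col_translatable_ex rg h.
- move: df of_ w => /= /andP[dg dh] /andP[og oh] [wg wh].
  have [|e1 [fc1 ov1 h1]] := IHg t _ dg og wg xS yS.
    by move=> u ug; apply: sub; rewrite /= mem_cat ug.
  have [|e2 [fc2 ov2 h2]] := IHh t _ dh oh wh xS yS.
    by move=> u uh; apply: sub; rewrite /= mem_cat uh orbT.
  exists (EHad e1 e2); split=> /=; rewrite ?fc1 ?ov1 // => db cons v vx vy.
  by rewrite entry_hadamard (h1 _ cons) // (h2 _ cons).
Qed.

(** * From translated bodies to matrix queries *)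

Definition rq_value (db : database K) (d : seq posn) : K :=
  let v x := nth pone d (index x (rq_vars Q)) in
  if map v (rq_vars Q) == d then sem db (rq_body Q) v else 0.

Lemma rq_funE (db : database K) d : rq_fun Q db d = rq_value db d.
Proof. by rewrite /rq_fun respectsE. Qed.

(** The range condition yields consistency of the output, the other one equality of the entries in
    range; out of range both matrices are zero. *)
Lemma expr_query (e : expr (mrow H) (mcol H)) :
  is_fc e -> expr_over S e ->
  (forall (db : database K) d, consistent Mat sg db ->
    size d = arity (rq_head Q) -> rq_value db d != 0 ->
    in_range Mat db H d) ->
  (forall (db : database K) (i j : posn), consistent Mat sg db ->
    (i <= dim db (mrow H))%N -> (j <= dim db (mcol H))%N ->
    rq_value db (entry_tuple (arity (rq_head Q)) (mcol H) i j) =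
    entry (eval (mat_inst Mat db) e) i j) ->
  exists (S : schema) (MQ : mquery S),
    is_fc_query MQ /\ mat_simulates K Q MQ Mat.
Proof.
move=> fc ov rg val.
have hS1 : rq_head Q \in voc_rels (rq_vocab Q) by rewrite !inE eqxx.
have fresh : H \notin sch_mats S by rewrite !inE eqxx.
have hK : enc_rel Mat H = rq_head Q := enc_matK Mat hS1.
exists S, (MQuery fresh ov); split=> //; split=> //.
  by apply: schema_eq => //=; apply: fsetD1K; apply: enc_mat_in.
move=> db cons; split=> [R RS1 d|].
  case: (eqVneq R (rq_head Q)) => [eR|ne].
    move: d; rewrite eR => d; rewrite /= dfwith_in /= rq_funE.
    by apply: rg; rewrite ?size_tuple.
  have RS : R \in voc_rels sg by move: RS1; rewrite !inE (negbTE ne).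
  by rewrite /= dfwith_out; [exact: cons|rewrite eq_sym].
split=> // A AS1 i j.
rewrite entry_mat_inst.
case: (eqVneq A H) => [eA|ne].
  rewrite eA /= dfwith_in hK dfwith_in; case: ifP => [/andP[im jn]|out].
    rewrite -val // /krel_at insubT; last first.
      by move=> st; rewrite /= rq_funE.
    rewrite /entry_tuple; case: (arity _) (enc_arity Mat hS1) => [|[|[|]]] //.
    by case: ifP.
  by rewrite entry_out.
rewrite /= [in RHS]dfwith_out; last by rewrite eq_sym.
rewrite dfwith_out; last first.
  by apply/eqP => e'; move: ne; rewrite -(enc_relK Mat AS1) -e' eqxx.
by rewrite -entry_mat_inst.
Qed.

Lemma form_over_vocab f : form_over sg f -> form_over (rq_vocab Q) f.
Proof.
elim: f => [R xs|x c|x g IH|g IHg h IHh|g IHg h IHh] //=.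
- by rewrite !inE => ->; rewrite orbT.
- by move=> /andP[/IHg-> /IHh->].
- by move=> /andP[/IHg-> /IHh->].
Qed.

Lemma fo2_to_fc : is_FO2_conj Q -> well_typed Mat Q ->
  exists (S : schema) (MQ : mquery S),
    is_fc_query MQ /\ mat_simulates K Q MQ Mat.
Proof.
move=> /and4P[df v2 _ ar] [t' ht' head].
have ov := rq_over Q; have ov' := form_over_vocab ov.
(* Variables outside the finite typing default to size 1, so that all sizes lie in the schema. *)
pose t x := odflt One t'.[? x]%fmap.
have tE x a : t'.[? x]%fmap = Some a -> t x = a by rewrite /t => ->.
have tS x : t x \in sch_sizes S1.
  rewrite /t; case xa: (t'.[? x])%fmap => [a|]; last exact: sch_one.
  exact: has_typing_sizes ov' ht' xa.
have w : wt Mat (rq_body Q) t by apply: has_typing_wt ov' ht' tE.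
have range (db : database K) v := fun cons => @sem_range db _ t v cons df ov w.
have fv z : (z \in tval (rq_vars Q)) = (z \in free_vars (rq_body Q)).
  exact: rq_free.
have fvv := @free_vars_sub (rq_body Q).
have cover x : x \in vars (rq_body Q) ->
    exists2 y, y != x & {subset vars (rq_body Q) <= [:: x; y]}.
  by move=> xv; apply: two_vars_cover; rewrite /= xv.
(* Sizes of variables that are not free can be chosen at will, so the expression gets the exact type
   of the head. *)
have trans x y a b : x != y -> {subset vars (rq_body Q) <= [:: x; y]} ->
    a \in sch_sizes S1 -> b \in sch_sizes S1 ->
    (x \in free_vars (rq_body Q) -> a = t x) ->
    (y \in free_vars (rq_body Q) -> b = t y) ->
    mx_translatable (rq_body Q) x y a b.
  move=> xy sub aS bS ax by_.
  pose u z := if z == x then a else if z == y then b else t z.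
  have ux : u x = a by rewrite /u eqxx.
  have uy : u y = b by rewrite /u eqxx eq_sym (negbTE xy).
  rewrite -ux -uy; apply: translate; rewrite ?ux ?uy //.
  apply: eq_wt w => z zf; rewrite /u.
  case: eqP => [zx|_]; first by rewrite ax -zx.
  by case: eqP => [zy|//]; rewrite by_ -zy.
have sz := size_tuple (rq_vars Q).
have query := @expr_query; move: head; rewrite /rq_value in query.
case exs : (tval (rq_vars Q)) sz => [|x [|y [|]]] //= sz;
  rewrite exs -sz /= in query.
- move=> [r c]; have nofv z : z \in free_vars (rq_body Q) -> False.
    by rewrite -fv exs.
  (* The body has no free variable; the first index is its first variable, or 0 if there is none,
     and both sizes are 1. *)
  have [|y yx sub] :=
      @two_vars_cover (vars (rq_body Q)) (head 0%N (vars (rq_body Q))).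
    move: v2; case: (vars (rq_body Q)) => [|u s] //=.
    by rewrite inE eqxx.
  rewrite eq_sym in yx.
  have [| | | |e [fc ove h]] := trans _ _ (mrow H) (mcol H) yx sub.
  + by rewrite r sch_one.
  + by rewrite c sch_one.
  + by move=> /nofv.
  + by move=> /nofv.
  apply: (query e fc ove) => [db d _|db i j cons].
    by case: d.
  rewrite {1}r {1}c !dim1 !leq_pone => /eqP-> /eqP->.
  rewrite (h _ cons) /= ?nth_nil //; exact: posn_gt0.
- move=> [a /tE xa rc].
  have xf : x \in free_vars (rq_body Q) by rewrite -fv exs inE.
  have [y yx sub] := cover x (fvv _ xf).
  have yf : y \in free_vars (rq_body Q) -> False.
    by rewrite -fv exs inE (negbTE yx).
  (* Column head: the second variable is not free and gets size 1. *)
  case: (eqVneq (mcol H) One) => c.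
    have r : mrow H = t x by rewrite xa; case: rc => [] [-> e] //; rewrite -e.
    have xy : x != y by rewrite eq_sym.
    have [| | | |e [fc ove h]] := trans _ _ (mrow H) (mcol H) xy sub.
    + by rewrite r.
    + by rewrite c sch_one.
    + by [].
    + by move=> /yf.
    apply: (query e fc ove) => [db [|i [|? ?]] cons|db i j cons im jn] //.
      rewrite /= eqxx /= eqxx => _ nz; rewrite c eqxx r.
      by have := range _ _ cons nz _ xf; rewrite eqxx.
    move: (jn); rewrite {1}c dim1 leq_pone => /eqP j1.
    rewrite (introT eqP c) /=.
    rewrite eqxx /= eqxx (h _ cons) /= ?eqxx ?(negbTE xy) ?j1 //=.
    exact: posn_gt0.
  (* Row head: the roles are exchanged, with [x] as the column index. *)
  have [r cx] : mrow H = One /\ mcol H = t x.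
    by rewrite xa; case: rc => [] [] // _ e; rewrite e eqxx in c.
  have [| | | | |e [fc ove h]] := trans _ _ (mrow H) (mcol H) yx.
  + by move=> z /sub; rewrite !inE orbC.
  + by rewrite r sch_one.
  + by rewrite cx.
  + by move=> /yf.
  + by [].
  apply: (query e fc ove) => [db [|i [|? ?]] cons|db i j cons im jn] //.
    rewrite /= eqxx /= eqxx => _ nz; rewrite (negbTE c) cx.
    by have := range _ _ cons nz _ xf; rewrite eqxx.
  move: (im); rewrite {1}r dim1 leq_pone => /eqP i1.
  rewrite (negbTE c) /=.
  rewrite eqxx /= eqxx (h _ cons) /= ?eqxx 1?eq_sym ?(negbTE yx) ?i1 //=.
  exact: posn_gt0.
- move=> [/tE xr /tE yc].
  have xf : x \in free_vars (rq_body Q) by rewrite -fv exs !inE eqxx.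
  have yf : y \in free_vars (rq_body Q) by rewrite -fv exs !inE eqxx orbT.
  have [z zx sub] := cover x (fvv _ xf).
  case: (eqVneq x y) => [xy|xy]; last first.
    have yz : y = z.
      by have := sub y (fvv _ yf); rewrite !inE eq_sym (negbTE xy) => /eqP.
    rewrite -yz in sub.
    have [| | | |e [fc ove h]] := trans _ _ (mrow H) (mcol H) xy sub.
    + by rewrite -xr.
    + by rewrite -yc.
    + by [].
    + by [].
    apply: (query e fc ove) => [db [|i [|j [|? ?]]] cons|db i j cons im jn] //.
      rewrite /= !eqxx (negbTE xy) /= eqxx => _ nz; rewrite -xr -yc.
      have := range _ _ cons nz _ xf; have := range _ _ cons nz _ yf.
      by rewrite /= !eqxx (negbTE xy) /= => -> ->.
    rewrite /= !eqxx (negbTE xy) /= eqxx.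
    by rewrite (h _ cons) /= !eqxx ?(negbTE xy).
  subst y.
  have rS : mrow H \in sch_sizes S by rewrite -xr.
  have rc : mrow H = mcol H by rewrite -xr.
  have xz : x != z by rewrite eq_sym.
  have [e' [fc' ove' h']] := id_expr rc rS.
  (* Head [H(x, x)]: only [x] is free in the body, so [z] gets size 1 and [e] is a column. *)
  have [| | | |e [fc ove h]] := trans _ _ (mrow H) One xz sub.
  + by [].
  + exact: sch_one.
  + by [].
  + by rewrite -fv exs !inE (negbTE zx).
  (* An outer product spreads the column over a square, and the identity masks it to the diagonal,
     as the repeated variable demands. *)
  apply: (query (EHad (EMul e (ETr (EOnes (mcol H)))) e')).
  + by rewrite /= fc fc' /vec_type eqxx orbT.
  + by rewrite /= ove ove' -rc rS.
  + move=> db [|i [|j [|? ?]]] cons // _.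
    rewrite /= !eqxx /= eqseq_cons eqxx eqseq_cons andbT /=.
    case: (eqVneq i j) => [<-|_]; last by rewrite eqxx.
    move=> nz; have := range _ _ cons nz _ xf.
    by rewrite eqxx /= -yc xr => ->.
  + move=> db i j cons im jn.
    rewrite /= !eqxx /= eqseq_cons eqxx eqseq_cons andbT /=.
    rewrite entry_hadamard (h' (mat_inst Mat db)) entry_mul_outer ?dim1 //.
    rewrite entry_tr entry_const im jn posn_gt0 /= mulr1.
    case: (eqVneq i j) => [ij|_]; last by rewrite mulr0.
    rewrite mulr1 (h _ cons) /= ?eqxx ?(negbTE xz) //.
    exact: posn_gt0.
Qed.

End ToExpr.

Theorem theorem7 (K : comNzSemiRingType) :
  (forall (S : schema) (MQ : mquery S), is_fc_query MQ ->
   forall (sg1 : vocab) (Rel : encoding (mq_schema MQ) sg1),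
   exists (sg : vocab) (Q : rquery sg),
     [/\ is_FO2_conj Q, rel_simulates K MQ Q Rel & well_typed Rel Q])
  /\
  (forall (sg : vocab) (Q : rquery sg), is_FO2_conj Q ->
   forall (S1 : schema) (Mat : encoding S1 (rq_vocab Q)), well_typed Mat Q ->
   exists (S : schema) (MQ : mquery S),
     is_fc_query MQ /\ mat_simulates K Q MQ Mat).
Proof.
split=> [S MQ fc sg1 Rel|sg Q fo S1 Mat typed]; first exact: fc_to_fo2.
exact: fo2_to_fc.
Qed.
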